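(* Let $\mathcal{X}$ be a compact metric space and $k$ a continuous, universal kernel on $\mathcal{X}$ with $\sup_x\sqrt{k(x,x)}\le K<\infty$ and RKHS $\mathcal{H}$. Let $P$ be a probability distribution on $\mathcal{X}\times\{+1,-1\}$ such that for some $\varepsilon_0>0$, $P(\{x:\varepsilon_0\le P(+1|x)\le1-\varepsilon_0\})>0$. Let $\ell:\mathbb{R}\to\mathbb{R}$ be non-decreasing, convex and non-negative, such that for every $M>0$ there is $z_0$ with $g\ge M$ for all $z\ge z_0$, $g\in\partial\ell(z)$. Let $T_1=\{(x_i,y_i)\}_{i=1}^{m_1}$ be i.i.d. from $P$, let $\lambda_{m_1}>0$ with $\lim_{m_1\to\infty}\lambda_{m_1}=\infty$, and let $(\widehat f,\widehat b,\widehat\rho)$ be an optimal solution of $$\min_{f\in\mathcal{H},b,\rho\in\mathbb{R}}\ -2\rho+\frac1{m_1}\sum_{i=1}^{m_1}\ell(\rho-y_i(f(x_i)+b))\quad\text{s.t. }\|f\|_{\mathcal{H}}\le\lambda_{m_1}.$$ Let $c,C>0$ and $M\in\mathbb{N}$ be constants such that for all $m_1\ge M$, with probability greater than $1-e^{-cm_1}$, $\|\widehat f\|_{\mathcal{H}}\le\lambda_{m_1}$, $|\widehat b|\le C\lambda_{m_1}$, $|\widehat\rho|\le C\lambda_{m_1}$. Let $\kappa_{m_1}$ be a Lipschitz constant of $\ell$ on $[-(K+2C)\lambda_{m_1},(K+2C)\lambda_{m_1}]$, $b_{m_1}=4C\lambda_{m_1}+\ell((K+2C)\lambda_{m_1})$,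 and $\mathcal{F}_{m_1}=\{f\in\mathcal{H}:\|f\|_{\mathcal{H}}\le\lambda_{m_1}\}$ with the supremum norm. Assume that for every $\varepsilon>0$, $$2\,\mathcal{N}\Big(\mathcal{F}_{m_1},\frac{\varepsilon}{9(2+\kappa_{m_1})}\Big)\Big(\frac{18C\lambda_{m_1}(2+\kappa_{m_1})}{\varepsilon}\Big)^2\exp\Big\{-\frac{2m_1\varepsilon^2}{9b_{m_1}^2}\Big\}\to0\quad(m_1\to\infty).$$ Then $\mathcal{R}(\widehat f+\widehat b,\widehat\rho)$ converges in probability to $\mathcal{R}^*$ as $m_1\to\infty$, where $\mathcal{R}(g,\rho)=-2\rho+\mathbb{E}_P[\ell(\rho-yg(x))]$ and $\mathcal{R}^*=\inf\{\mathcal{R}(g,\rho):g\in L_0(\mathcal{X}),\rho\in\mathbb{R}\}$.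
   Context: A kernel is universal if its RKHS is dense in the continuous functions on $\mathcal{X}$ in supremum norm. $\mathcal{N}(\mathcal{G},\varepsilon)$ is the minimal number of closed $\varepsilon$-balls centered at points of $\mathcal{G}$ needed to cover the metric space $\mathcal{G}$. $L_0(\mathcal{X})$ denotes measurable functions on $\mathcal{X}$; $\partial\ell$ the subdifferential. (Constants $c,C,M$ as in the hypothesis exist under these assumptions.) *)

(* Defs.v *)
From HB Require Import structures.
From mathcomp Require Import all_boot all_order all_algebra.
From mathcomp Require Import all_classical all_reals all_analysis.
Set Implicit Arguments. Unset Strict Implicit. Unset Printing Implicit Defensive.
Import Order.TTheory GRing.Theory Num.Theory.
Import numFieldNormedType.Exports.
Local Open Scope classical_set_scope.
Local Open Scope ring_scope.

Section Defs.
Variable R : realType.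

Definition sgnb (y : bool) : R := if y then 1 else -1.

Definition borelT (X : pseudoPMetricType R) := g_sigma_algebraType (@open X).

Definition rkhs_norm (X : Type) (ip : (X -> R) -> (X -> R) -> R) (f : X -> R) : R :=
  Num.sqrt (ip f f).

Definition is_RKHS (X : Type) (k : X -> X -> R) (H : set (X -> R))
  (ip : (X -> R) -> (X -> R) -> R) : Prop :=
  H (fun _ => 0) /\
  (forall f g (a : R), H f -> H g -> H (fun x => a * f x + g x)) /\
  (forall f g h (a : R), H f -> H g -> H h ->
      ip (fun x => a * f x + g x) h = a * ip f h + ip g h) /\
  (forall f g, H f -> H g -> ip f g = ip g f) /\
  (forall f, H f -> 0 <= ip f f /\ (ip f f = 0 -> f = (fun _ => 0))) /\
  (forall x, H (k x) /\ forall f, H f -> f x = ip f (k x)) /\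
  (forall u : nat -> X -> R, (forall n, H (u n)) ->
        (forall e : R, 0 < e -> exists N : nat, forall n m, (N <= n)%N -> (N <= m)%N ->
             rkhs_norm ip (fun x => u n x - u m x) < e) ->
        exists f, H f /\
          (fun n => rkhs_norm ip (fun x => u n x - f x)) @ \oo --> (0 : R)).

Definition universal_rkhs (X : topologicalType) (H : set (X -> R)) : Prop :=
  forall g : X -> R, continuous g -> forall e : R, 0 < e ->
    exists f, H f /\ forall x, `|f x - g x| < e.

Definition loss_nondecr (l : R -> R) := forall u v, u <= v -> l u <= l v.

Definition loss_convex (l : R -> R) := forall u v (t : R), 0 <= t <= 1 ->
  l (t * u + (1 - t) * v) <= t * l u + (1 - t) * l v.

Definition subdiff (l : R -> R) (z : R) : set R :=
  [set g | forall w, l z + g * (w - z) <= l w].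

Definition loss_lipschitz_on (l : R -> R) (a b kap : R) :=
  forall u v, a <= u <= b -> a <= v <= b -> `|l u - l v| <= kap * `|u - v|.

Definition covN (X : Type) (G : set (X -> R)) (eps : R) : \bar R :=
  ereal_inf [set (n%:R)%:E | n in [set n : nat | exists c : 'I_n -> X -> R,
     (forall i, G (c i)) /\
     (forall g, G g -> exists i, forall x, `|g x - c i x| <= eps)]].

Definition cond_prob_pos (X : pseudoPMetricType R)
   (P : probability (borelT X * bool)%type R) (eta : borelT X -> R) : Prop :=
  [/\ measurable_fun setT eta, (forall x, 0 <= eta x <= 1) &
      forall A : set (borelT X), measurable A ->
        P (A `*` [set true]) = (\int[P]_(z in A `*` setT) (eta z.1)%:E)%E].

Definition risk (X : pseudoPMetricType R)
   (P : probability (borelT X * bool)%type R) (l : R -> R) (g : X -> R) (rho : R)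
   : \bar R :=
  ((- (2 * rho))%:E + \int[P]_z (l (rho - sgnb z.2 * g z.1))%:E)%E.

Definition risk_star (X : pseudoPMetricType R)
   (P : probability (borelT X * bool)%type R) (l : R -> R) : \bar R :=
  ereal_inf [set r | exists (g : borelT X -> R) (rho : R),
     measurable_fun setT g /\ r = risk P l g rho].

Definition emp_obj (X : Type) (l : R -> R) (S : nat -> X * bool) (m : nat)
   (f : X -> R) (b rho : R) : R :=
  - (2 * rho) + m%:R^-1 * \sum_(i < m) l (rho - sgnb (S i).2 * (f (S i).1 + b)).

Definition is_opt (X : Type) (l : R -> R) (H : set (X -> R))
   (ip : (X -> R) -> (X -> R) -> R) (lam : R) (S : nat -> X * bool) (m : nat)
   (f : X -> R) (b rho : R) : Prop :=
  [/\ H f, rkhs_norm ip f <= lam &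
      forall f' b' rho', H f' -> rkhs_norm ip f' <= lam ->
        emp_obj l S m f b rho <= emp_obj l S m f' b' rho'].

Definition iid_law (d : measure_display) (Omega : measurableType d)
   (Pr : probability Omega R) (X : pseudoPMetricType R)
   (Z : nat -> Omega -> (borelT X * bool)%type)
   (P : probability (borelT X * bool)%type R) : Prop :=
  (forall i, measurable_fun setT (Z i)) /\
  forall (n : nat) (A : nat -> set (borelT X * bool)%type),
    (forall i, measurable (A i)) ->
    Pr (\bigcap_(i in `I_n) (Z i @^-1` A i)) = (\prod_(i < n) P (A i))%E.

End Defs.

(* Main.v *)
(** The risk of the estimator lies above [R*] because functions of the RKHS are
continuous, hence measurable; it is bounded from above by comparing the
estimator with a fixed near-optimal pair [(f0, rho0)], [f0] in [H]. Such a pair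
exists because truncation, density of continuous functions in [L1(P)] and
universality change the risk of a measurable function by an arbitrarily small
amount. As [lam m] tends to infinity the pair becomes feasible, and on an event of
probability tending to one the empirical and true risks are uniformly close on the
feasible set (Hoeffding at the points of a net, then a union bound), so that
optimality transfers from the empirical to the true risk. That [R*] is finite uses
the noise condition: any [g] has nonpositive margin with probability at least
some [q > 0], so the risk is at least [-2 rho + q l(rho)], and [l] is superlinear. *)

Require Import Defs.
From HB Require Import structures.
From mathcomp Require Import all_boot all_order all_algebra.
From mathcomp Require Import all_classical all_reals all_analysis.
From mathcomp Require Import measurable_realfun.
From mathcomp Require Import ring lra.
Set Implicit Arguments. Unset Strict Implicit. Unset Printing Implicit Defensive.
Import Order.TTheory GRing.Theory Num.Theory.
Import numFieldNormedType.Exports.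
Local Open Scope classical_set_scope.
Local Open Scope ring_scope.

(** * Reproducing kernel Hilbert spaces *)

(** The estimator is not assumed measurable in the sample point, and a supremum of deviations over
    the feasible set need not be measurable either. Bad events are therefore enclosed in explicit
    measurable sets: a finite union of deviation events at net points, joined to the complement of
    the event given by the high-probability hypothesis. The radius, the grid sizes and the exponent
    must fit the given covering condition, which dictates the constants of the deviation bound. A
    second obstacle is that an arbitrary measurable function may have infinite risk: approximation
    steps bound one extended-real risk by another plus an error, and never subtract. Risks become
    real numbers only for bounded margins, where the final comparison takes place. *)

Section rkhs.
Context {R : realType} {X : Type} {k : X -> X -> R} {H : set (X -> R)}
  {ip : (X -> R) -> (X -> R) -> R} (HR : is_RKHS k H ip).

Lemma rkhs_lin f g a : H f -> H g -> H (fun x => a * f x + g x).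
Proof. by case: HR => _ [+ _]; exact. Qed.

Lemma rkhs_ip_lin f g h a : H f -> H g -> H h ->
  ip (fun x => a * f x + g x) h = a * ip f h + ip g h.
Proof. by case: HR => _ [_ [+ _]]; exact. Qed.

Lemma rkhs_ipC f g : H f -> H g -> ip f g = ip g f.
Proof. by case: HR => _ [_ [_ [+ _]]]; exact. Qed.

Lemma rkhs_ip_ge0 f : H f -> 0 <= ip f f.
Proof. by case: HR => _ [_ [_ [_ [+ _]]]] Hf => /(_ f Hf)[]. Qed.

Lemma rkhs_kernel x : H (k x).
Proof. by case: HR => _ [_ [_ [_ [_ [+ _]]]]] => /(_ x)[]. Qed.

Lemma rkhs_reproducing f x : H f -> f x = ip f (k x).
Proof. by case: HR => _ [_ [_ [_ [_ [+ _]]]]] => /(_ x)[_]; exact. Qed.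

Lemma rkhs_norm_lin f g a : H f -> H g ->
  ip (fun x => a * f x + g x) (fun x => a * f x + g x) =
  a ^+ 2 * ip f f + 2 * a * ip f g + ip g g.
Proof.
move=> Hf Hg; have Hh := rkhs_lin a Hf Hg.
rewrite rkhs_ip_lin// (rkhs_ipC Hf Hh) (rkhs_ipC Hg Hh) !rkhs_ip_lin//.
by rewrite (rkhs_ipC Hg Hf); ring.
Qed.

(** The squared norm of [a * f + g] is a nonnegative quadratic in [a], evaluated at its minimiser
    [- ip f g / ip f f]. If [ip f f = 0] it is affine in [a], so its slope must vanish. *)
Lemma rkhs_cauchy_schwarz f g : H f -> H g -> ip f g ^+ 2 <= ip f f * ip g g.
Proof.
move=> Hf Hg; have f0 := rkhs_ip_ge0 Hf; have g0 := rkhs_ip_ge0 Hg.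
have q a : 0 <= a ^+ 2 * ip f f + 2 * a * ip f g + ip g g.
  by rewrite -rkhs_norm_lin//; apply/rkhs_ip_ge0/rkhs_lin.
have [f_eq0|f_neq0] := eqVneq (ip f f) 0.
  rewrite f_eq0 mul0r; have [->|fg0] := eqVneq (ip f g) 0; first by rewrite expr0n.
  (* At this [a] a nonconstant affine function would take the value [-1]. *)
  have := q (- (ip g g + 1) / (2 * ip f g)); rewrite f_eq0 mulr0 add0r.
  suff -> : 2 * (- (ip g g + 1) / (2 * ip f g)) * ip f g + ip g g = -1 by lra.
  by field.
have := q (- ip f g / ip f f).
suff -> : (- ip f g / ip f f) ^+ 2 * ip f f + 2 * (- ip f g / ip f f) * ip f g +
   ip g g = (ip f f * ip g g - ip f g ^+ 2) / ip f f.
  by rewrite pmulr_lge0 ?subr_ge0// invr_gt0 lt_def f_neq0.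
by field.
Qed.

Lemma rkhs_sup_bound f x : H f -> `|f x| <= rkhs_norm ip f * Num.sqrt (k x x).
Proof.
move=> Hf; rewrite /rkhs_norm -sqrtrM ?rkhs_ip_ge0// -sqrtr_sqr ler_sqrt.
  rewrite (rkhs_reproducing x Hf) (rkhs_reproducing x (rkhs_kernel x)).
  exact: rkhs_cauchy_schwarz (rkhs_kernel x).
by rewrite (rkhs_reproducing x (rkhs_kernel x)) mulr_ge0 ?rkhs_ip_ge0//; exact: rkhs_kernel.
Qed.

(** Cauchy-Schwarz against [k y - k x], whose squared norm is the bracket on the right. That bracket
    tends to 0 as [y] tends to [x], so continuity of [k] passes to every element of [H]. *)
Lemma rkhs_diff_bound f x y : H f ->
  (f y - f x) ^+ 2 <= ip f f * (k y y - 2 * k x y + k x x).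
Proof.
move=> Hf; have Hx := rkhs_kernel x; have Hy := rkhs_kernel y.
have Hd := rkhs_lin (-1) Hx Hy.
have -> : f y - f x = ip f (fun z => -1 * k x z + k y z).
  by rewrite (rkhs_ipC Hf Hd) rkhs_ip_lin// !(rkhs_ipC _ Hf)// -!rkhs_reproducing//; ring.
suff -> : k y y - 2 * k x y + k x x =
    ip (fun z => -1 * k x z + k y z) (fun z => -1 * k x z + k y z).
  exact: rkhs_cauchy_schwarz.
rewrite rkhs_norm_lin// -!rkhs_reproducing//; ring.
Qed.

End rkhs.

Lemma rkhs_continuous (R : realType) (X : topologicalType) (k : X -> X -> R)
    (H : set (X -> R)) (ip : (X -> R) -> (X -> R) -> R) (f : X -> R) :
  continuous (fun p : X * X => k p.1 p.2) -> is_RKHS k H ip -> H f -> continuous f.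
Proof.
move=> kc HR Hf x.
have kyy : (fun y => k y y) @ x --> k x x.
  by apply: (@continuous_comp _ _ _ (fun y => (y, y)) (fun p : X * X => k p.1 p.2));
     [apply: cvg_pair => //=; exact: cvg_id|exact: kc].
have kxy : (fun y => k x y) @ x --> k x x.
  by apply: (@continuous_comp _ _ _ (fun y => (x, y)) (fun p : X * X => k p.1 p.2));
     [apply: cvg_pair => //=; exact: cvg_cst|exact: kc].
have c0 : (fun y => ip f f * (k y y - 2 * k x y + k x x)) @ x --> (0 : R).
  rewrite [X in _ --> X](_ : _ = ip f f * (k x x - 2 * k x x + k x x)); last by ring.
  apply: cvgM; first exact: cvg_cst.
  by apply: cvgD; [apply: cvgB => //; apply: cvgM => //; exact: cvg_cst|exact: cvg_cst].
apply/cvgrPdist_lt => e e0.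
have e20 : 0 < e ^+ 2 by rewrite exprn_gt0.
move/cvgrPdist_lt : c0 => /(_ _ e20); apply: filterS => y.
rewrite sub0r normrN => /(le_lt_trans (ler_norm _)) /(le_lt_trans (rkhs_diff_bound HR x y Hf)).
by rewrite -real_normK ?num_real// ltr_pXn2r ?nnegrE ?(ltW e0)// distrC.
Qed.

(** * Borel measurability of margins and losses *)

Section measurability.
Context {R : realType} {X : pseudoPMetricType R}.

Lemma continuous_borelT (f : X -> R) : continuous f ->
  measurable_fun [set: borelT X] (f : borelT X -> R).
Proof.
move=> fc; apply: (measurability _ (RGenOpens.measurableE R)).
move=> _ [_ [a [b ->]] <-]; rewrite setTI; apply: sub_sigma_algebra.
by move/continuousP : fc; apply; exact: interval_open.
Qed.

Lemma measurable_sgnb : measurable_fun [set: bool] (@sgnb R).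
Proof. by []. Qed.

Lemma measurable_margin (g : borelT X -> R) (b rho : R) : measurable_fun setT g ->
  measurable_fun [set: borelT X * bool] (fun z => rho - sgnb R z.2 * (g z.1 + b)).
Proof.
move=> mg; apply: measurable_funB => //; apply: measurable_funM.
  exact: (measurableT_comp measurable_sgnb).
by apply: measurable_funD => //; exact: (measurableT_comp mg).
Qed.

Lemma measurable_loss (l : R -> R) (g : borelT X -> R) (b rho : R) :
  loss_nondecr l -> measurable_fun setT g ->
  measurable_fun [set: borelT X * bool] (fun z => l (rho - sgnb R z.2 * (g z.1 + b))).
Proof.
move=> nd mg; apply: (@measurableT_comp _ _ _ _ _ _ l) (measurable_margin b rho mg).
apply: nondecreasing_measurable => //; exact: measurableT.
Qed.

End measurability.
(** * Independence and Hoeffding's inequality *)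

Section independence.
Context {R : realType}.
Local Open Scope ereal_scope.
Import HBNNSimple.

(** In the application [w] is the product of the other factors and [c] its expectation. The product
    rule goes from indicators to simple functions by linearity, then to nonnegative functions by
    monotone convergence. *)
Lemma ge0_integral_factor d d' (Omega : measurableType d) (T : measurableType d')
    (mu : {measure set Omega -> \bar R}) (P : {measure set T -> \bar R})
    (Z : Omega -> T) (w : Omega -> R) (c : R) :
  measurable_fun setT Z -> measurable_fun setT w -> (forall x, 0 <= w x)%R ->
  (forall B, measurable B -> \int[mu]_x (w x * \1_B (Z x))%:E = c%:E * P B) ->
  forall h : T -> R, measurable_fun setT h -> (forall x, 0 <= h x)%R ->
  \int[mu]_x (w x * h (Z x))%:E = c%:E * \int[P]_y (h y)%:E.
Proof.
move=> mZ mw w0 wP h mh h0.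
have mhZ (g : T -> R) : measurable_fun setT g ->
    measurable_fun setT (fun x => (w x * g (Z x))%:E).
  move=> mg; apply/measurable_EFinP; apply: measurable_funM => //.
  exact: measurableT_comp.
have sfun_case (g : {nnsfun T >-> R}) :
    \int[mu]_x (w x * g (Z x))%:E = c%:E * \int[P]_y (g y)%:E.
  rewrite integralT_nnsfun sintegralE ge0_mule_fsumr; last first.
    by move=> r; exact: nnsfun_mulemu_ge0.
  transitivity (\int[mu]_x (\sum_(r \in range g)
      (r%:E * (w x * \1_(g @^-1` [set r]) (Z x))%:E))).
    apply: eq_integral => x _; rewrite EFinM fimfunE -fsumEFin// ge0_mule_fsumr.
      by apply: eq_fsbigr => r _; rewrite !EFinM muleCA.
    by move=> r; exact: nnfun_muleindic_ge0.
  have msr r : measurable (g @^-1` [set r]) by exact: measurable_sfunP.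
  rewrite ge0_integral_fsum//.
  - apply: eq_fsbigr => r /[!inE] -[y _ gyr].
    rewrite ge0_integralZl//.
    + by rewrite wP// muleCA.
    + by apply: mhZ; exact: measurable_indic.
    + by move=> x _; rewrite lee_fin mulr_ge0.
    + by rewrite -gyr lee_fin.
  - by move=> r; apply: measurable_funeM; apply: mhZ; exact: measurable_indic.
  - move=> r x _; rewrite EFinM muleCA mule_ge0 ?lee_fin//.
    exact: nnfun_muleindic_ge0.
have mEh : measurable_fun setT (EFin \o h) by exact/measurable_EFinP.
pose g := nnsfun_approx measurableT mEh.
have gh y : EFin \o g^~ y @ \oo --> (h y)%:E.
  by apply: cvg_nnsfun_approx => // ? _; rewrite lee_fin.
have cw : \int[mu]_x (w x * g n (Z x))%:E @[n --> \oo] --> \int[mu]_x (w x * h (Z x))%:E.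
  have -> : \int[mu]_x (w x * h (Z x))%:E = \int[mu]_x limn (fun n => (w x * g n (Z x))%:E).
    apply: eq_integral => x _; apply/esym/cvg_lim => //.
    under eq_fun do rewrite EFinM.
    by rewrite EFinM; apply: cvgeZl => //; exact: gh.
  apply: (@cvg_monotone_convergence _ _ _ mu _ measurableT (fun n x => (w x * g n (Z x))%:E)).
  - by move=> n; exact: mhZ.
  - by move=> n x _; rewrite lee_fin mulr_ge0.
  - move=> x _ m n mn; rewrite lee_fin ler_wpM2l//.
    exact/lefP/nd_nnsfun_approx.
have cg : \int[P]_y (g n y)%:E @[n --> \oo] --> \int[P]_y (h y)%:E.
  have -> : \int[P]_y (h y)%:E = \int[P]_y limn (fun n => (g n y)%:E).
    by apply: eq_integral => y _; apply/esym/cvg_lim => //; exact: gh.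
  apply: (@cvg_monotone_convergence _ _ _ P _ measurableT (fun n x => (g n x)%:E)).
  - by move=> n; exact/measurable_EFinP.
  - by move=> n x _; rewrite lee_fin.
  - move=> x _ m n mn; rewrite lee_fin.
    exact/lefP/nd_nnsfun_approx.
apply: (cvg_unique _ cw) => //=.
rewrite (eq_cvg _ _ (fun n => sfun_case (g n))).
exact: cvgeZl.
Qed.

(* The functions are exchanged for indicators one coordinate at a time, the
   case of indicators being the product rule [iid]. *)
Lemma iid_integral_prod d d' (Omega : measurableType d) (T : measurableType d')
    (Pr : probability Omega R) (P : probability T R) (Z : nat -> Omega -> T) :
  (forall i, measurable_fun setT (Z i)) ->
  (forall n A, (forall i, measurable (A i)) ->
     Pr (\bigcap_(i in `I_n) (Z i @^-1` A i)) = \prod_(i < n) P (A i)) ->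
  forall n (h : nat -> T -> R) (I : nat -> R),
  (forall i, measurable_fun setT (h i)) -> (forall i x, 0 <= h i x)%R ->
  (forall i, \int[P]_x (h i x)%:E = (I i)%:E) ->
  \int[Pr]_w (\prod_(i < n) h i (Z i w))%:E = (\prod_(i < n) I i)%:E.
Proof.
move=> mZ iid n.
(* Only the coordinates below [j] carry arbitrary functions; for [j = n] the indicator condition is
   void. *)
suff gen j : forall (h : nat -> T -> R) (I : nat -> R),
    (forall i, measurable_fun setT (h i)) -> (forall i x, 0 <= h i x)%R ->
    (forall i, \int[P]_x (h i x)%:E = (I i)%:E) ->
    (forall i, (j <= i < n)%N -> exists2 A, measurable A & h i = \1_A) ->
    \int[Pr]_w (\prod_(i < n) h i (Z i w))%:E = (\prod_(i < n) I i)%:E.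
  move=> h I mh h0 hI; apply: (gen n h I) => // i /andP[ni /(leq_ltn_trans ni)].
  by rewrite ltnn.
elim: j => [|j IH] h I mh h0 hI hind.
  (* [iid] takes a whole sequence of measurable sets, so indices from [n] on receive the default
     [setT]. *)
  have /choice[A AP] : forall i, exists A, measurable A /\ ((i < n)%N -> h i = \1_A).
    move=> i; case: (ltnP i n) => [iltn|_]; last by exists setT.
    by have [A mA hA] := hind i iltn; exists A.
  have mA i : measurable (A i) by case: (AP i).
  have hA i : (i < n)%N -> h i = \1_(A i) by case: (AP i).
  have -> : (\prod_(i < n) I i)%:E = \prod_(i < n) P (A i).
    rewrite -prodEFin; apply: eq_bigr => i _.
    by rewrite -hI hA// integral_indic// setIT.
  rewrite -iid// -[\bigcap_(i in _) _]setIT -integral_indic//.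
    apply: eq_integral => w _; congr (_%:E).
    under eq_bigr => i _ do rewrite hA// indicE.
    rewrite indicE; case: (asboolP (forall i : 'I_n, A i (Z i w))) => [wA|wA].
      rewrite mem_set; last by move=> i /= ilt; exact: (wA (Ordinal ilt)).
      by rewrite big1// => i _; rewrite mem_set//.
    rewrite memNset; last by apply: contra_not wA => wB i; exact: wB (ltn_ord i).
    have /existsNP[i wAi] := wA.
    by rewrite (bigD1 i)//= memNset// mul0r.
  apply: fin_bigcap_measurable => [|i _]; first exact: finite_II.
  by rewrite -[X in measurable X]setTI; exact: mZ.
case: (ltnP j n) => [jn|nj]; last first.
  by apply: IH => // i /andP[ji]; rewrite ltnNge (leq_trans nj ji).
pose J := Ordinal jn.
have IHB B : measurable B ->
    \int[Pr]_w ((\prod_(i < n | i != J) h i (Z i w)) * \1_B (Z J w))%:E =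
    (\prod_(i < n | i != J) I i)%:E * P B.
  move=> mB.
  have := IH (fun i => if i == j then \1_B else h i)
    (fun i => if i == j then fine (P B) else I i).
  rewrite (bigD1 J)//= eqxx (eq_bigr (fun i : 'I_n => I i)); last first.
    by move=> i; rewrite -val_eqE /= => /negbTE ->.
  rewrite mulrC EFinM fineK ?fin_num_measure// => <-.
  - apply: eq_integral => w _; rewrite [in RHS](bigD1 J)//= eqxx mulrC; congr (_ * _)%:E.
    by apply: eq_bigr => i; rewrite -val_eqE /= => /negbTE ->.
  - by move=> i; case: ifP => // _; exact: measurable_indic.
  - by move=> i x; case: ifP => // _.
  - move=> i; case: ifP => // _.
    by rewrite integral_indic// setIT fineK// fin_num_measure.
  - move=> i /andP[ji iltn]; case: eqVneq => [|ij]; first by exists B.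
    by apply: hind; rewrite iltn andbT ltn_neqAle eq_sym ij.
under eq_integral do rewrite (bigD1 J)//= mulrC.
rewrite (ge0_integral_factor (P := P) (Z := Z J) _ _ _ IHB)//.
- by rewrite hI [in RHS](bigD1 J)//= -EFinM mulrC.
- under eq_fun do rewrite big_mkcond /=.
  apply: measurable_prod => i _.
  by case: (i != J); [exact: measurableT_comp|exact: measurable_cst].
- by move=> x; apply: prodr_ge0.
Qed.

End independence.

(** * Exponential tail bounds for bounded functions *)

Section hoeffding.
Context {R : realType}.

Lemma integrable_bounded d (T : measurableType d) (P : probability T R) (f : T -> R) B :
  measurable_fun setT f -> (forall x, `|f x| <= B) -> P.-integrable setT (EFin \o f).
Proof.
move=> mf fB; apply: measurable_bounded_integrable => //.
  by rewrite (le_lt_trans (probability_le1 _ _))// ltry.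
exists B; split; first exact: num_real.
by move=> b /ltW Bb x _; exact: le_trans (fB x) Bb.
Qed.

Lemma normr_itv_bound (a b u : R) : a <= u <= a + b -> `|u| <= `|a| + `|a + b|.
Proof.
move=> /andP[au ub]; rewrite ler_norml.
have := ler_norm (- a); have := ler_norm (a + b); have := normr_ge0 a.
by have := normr_ge0 (a + b); rewrite normrN; lra.
Qed.

Lemma EFin_Rintegral d (T : measurableType d) (P : probability T R) (f : T -> R) :
  P.-integrable setT (EFin \o f) -> (\int[P]_x (f x)%:E = (\int[P]_x f x)%R%:E)%E.
Proof. by move=> fi; rewrite /Rintegral fineK// integrable_fin_num. Qed.

Lemma Rintegral_prob_cst d (T : measurableType d) (P : probability T R) (r : R) :
  \int[P]_x r = r.
Proof.
rewrite Rintegral_cst//; transitivity (r * fine (1%E : \bar R)); last exact: mulr1.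
by congr (_ * fine _); exact: probability_setT.
Qed.

(** Squaring [1 - x / 2 <= expR (- (x / 2))] gives [expR x * (1 - x / 2) ^+ 2 <= 1]. The claim
    follows as [(1 + x + x ^+ 2) * (1 - x / 2) ^+ 2 - 1 = x ^+ 2 * (1 - 3 * x + x ^+ 2) / 4],
    nonnegative in this range. *)
Lemma expR_quadratic_bound (x : R) : `|x| <= 1 / 4 -> expR x <= 1 + x + x ^+ 2.
Proof.
rewrite ler_norml => /andP[xl xu].
have h : 1 - x / 2 <= expR (- (x / 2)) by exact: expR_ge1Dx.
have h0 : 0 < 1 - x / 2 by lra.
have e0 := expR_gt0 x.
have : expR x * (1 - x / 2) ^+ 2 <= 1.
  have e1 : expR x * expR (- (x / 2)) ^+ 2 = 1.
    by rewrite -expRM_natl -expRD -expR0; congr expR; field.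
  rewrite -[leRHS]e1 ler_wpM2l ?(ltW e0)// lerXn2r// nnegrE; first exact: ltW.
  exact: expR_ge0.
nra.
Qed.

(** The centred exponent is at most [s * b] in absolute value. In the quadratic bound its linear
    term integrates to 0, leaving [1 + (s * b) ^+ 2]. *)
Lemma mgf_bound d (T : measurableType d) (P : probability T R) (f : T -> R) (a b s : R) :
  measurable_fun setT f -> (forall x, a <= f x <= a + b) -> 0 <= s -> s * b <= 1 / 4 ->
  \int[P]_x expR (s * (f x - \int[P]_x f x)) <= expR ((s * b) ^+ 2).
Proof.
move=> mf fab s0 sb; set mu := (\int[P]_x f x)%R.
have fi : P.-integrable setT (EFin \o f).
  by apply: (@integrable_bounded _ _ _ _ (`|a| + `|a + b|)) => // x; exact: normr_itv_bound.
have ci r : P.-integrable setT (EFin \o cst r).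
  by apply: (@integrable_bounded _ _ _ _ `|r|).
have muab : a <= mu <= a + b.
  apply/andP; split.
    rewrite -(Rintegral_prob_cst P a); apply: le_Rintegral => // [|x _]; first exact: ci.
    by case/andP : (fab x).
  rewrite -[leRHS](Rintegral_prob_cst P); apply: le_Rintegral => // [|x _]; first exact: ci.
  by case/andP : (fab x).
have fmu x : `|s * (f x - mu)| <= s * b.
  by rewrite normrM ger0_norm// ler_wpM2l// ler_norml; have := fab x; lra.
apply: (@le_trans _ _ (\int[P]_x ((1 - s * mu + (s * b) ^+ 2) + s * f x))).
  apply: le_Rintegral => //.
  - apply: (@integrable_bounded _ _ _ _ (expR (s * b))).
      apply: measurableT_comp => //; apply: measurable_funM => //.
      exact: measurable_funB.
    by move=> x; rewrite ger0_norm ?expR_ge0// ler_expR (le_trans (ler_norm _)).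
  - apply: (@integrable_bounded _ _ _ _ (`|1 - s * mu + (s * b) ^+ 2| + `|s| * (`|a| + `|a + b|))).
      by apply: measurable_funD => //; apply: measurable_funM.
    move=> x; rewrite (le_trans (ler_normD _ _))// lerD2l normrM ler_wpM2l//.
    exact: normr_itv_bound.
  - move=> x _; apply: le_trans (expR_quadratic_bound (le_trans (fmu x) sb)) _.
    have : (s * (f x - mu)) ^+ 2 <= (s * b) ^+ 2.
      rewrite -real_normK ?num_real// lerXn2r// nnegrE//.
      exact: le_trans (normr_ge0 _) (fmu x).
    lra.
rewrite RintegralD//; [|exact: ci|]; last first.
  apply: (@integrable_bounded _ _ _ _ (`|s| * (`|a| + `|a + b|))).
    exact: measurable_funM.
  by move=> x; rewrite normrM ler_wpM2l// normr_itv_bound.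
rewrite RintegralZl// -/mu Rintegral_prob_cst.
apply: le_trans (expR_ge1Dx _).
lra.
Qed.

Section tail.
Context {d d' : measure_display} {Omega : measurableType d} {T : measurableType d'}
  (Pr : probability Omega R) (P : probability T R) (Z : nat -> Omega -> T).
Hypothesis mZ : forall i, measurable_fun setT (Z i).
Hypothesis iid : forall n A, (forall i, measurable (A i)) ->
  Pr (\bigcap_(i in `I_n) (Z i @^-1` A i)) = (\prod_(i < n) P (A i))%E.

Definition emp_dev (f : T -> R) (m : nat) (w : Omega) : R :=
  m%:R^-1 * (\sum_(i < m) f (Z i w)) - \int[P]_x f x.

Lemma measurable_emp_dev f m : measurable_fun setT f ->
  measurable_fun setT (emp_dev f m).
Proof.
move=> mf; apply: measurable_funB => //; apply: measurable_funM => //.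
by apply: measurable_sum => i; exact: measurableT_comp.
Qed.

(* The quadratic bound on [expR] costs a constant in the exponent, [1 / 4] instead
   of [2], which the uniform deviation bound absorbs by using [t = eps]. *)
Lemma emp_dev_upper_tail (f : T -> R) (a b t : R) m :
  measurable_fun setT f -> (forall x, a <= f x <= a + b) ->
  (0 < m)%N -> 0 < t -> 2 * t <= b ->
  (Pr [set w | (t <= emp_dev f m w)%R] <= (expR (- (m%:R * t ^+ 2 / (4 * b ^+ 2))))%:E)%E.
Proof.
move=> mf fab m0 t0 tb.
have b0 : 0 < b by lra.
have mR : 0 < m%:R :> R by rewrite ltr0n.
(* Minimises the exponent [- s * m * t + m * (s * b) ^+ 2]; [2 * t <= b] then gives
   [s * b <= 1 / 4], the range of [mgf_bound]. *)
pose s := t / (2 * b ^+ 2).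
have s0 : 0 < s by rewrite divr_gt0// mulr_gt0// exprn_gt0.
have sbE : s * b = t / (2 * b) by rewrite /s; field; lra.
have sb : s * b <= 1 / 4 by rewrite sbE ler_pdivrMr; lra.
pose mu := \int[P]_x f x.
pose h x := expR (s * (f x - mu)).
have mh : measurable_fun setT h.
  by apply: measurableT_comp => //; apply: measurable_funM => //; exact: measurable_funB.
have hi : P.-integrable setT (EFin \o h).
  apply: (@integrable_bounded _ _ _ _ (expR (s * (`|a| + `|a + b| + `|mu|)))) => //.
  move=> x; rewrite /h [`|expR _|]ger0_norm ?expR_ge0// ler_expR ler_wpM2l ?(ltW s0)//.
  by have := normr_itv_bound (fab x); have := ler_norm (f x); have := ler_norm (- mu); rewrite normrN; lra.
have mS : measurable [set w | t <= emp_dev f m w].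
  rewrite -[X in measurable X]setTI.
  by apply: measurable_fun_le => //; exact: measurable_emp_dev.
rewrite -[X in Pr X]setIT -integral_indic//.
(* Chernoff: the indicator of the event lies below this exponential, whose expectation factorises by
   independence. *)
apply: (@le_trans _ _ (\int[Pr]_w ((expR (- (s * m%:R * t)))%:E *
    (\prod_(i < m) h (Z i w))%:E))%E).
  apply: ge0_le_integral => //.
  - exact/measurable_EFinP/measurable_indic.
  - apply: measurable_funeM; apply/measurable_EFinP; apply: measurable_prod => i _.
    exact: measurableT_comp.
  - move=> w _; rewrite -EFinM lee_fin indicE.
    have p0 : 0 <= expR (- (s * m%:R * t)) * \prod_(i < m) h (Z i w).
      by rewrite mulr_ge0 ?expR_ge0// prodr_ge0// => i _; exact: expR_ge0.
    case: (boolP (w \in _)) => //; rewrite inE /= => tw.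
    rewrite -expR_sum -expRD -[leLHS]/(1 : R) -[leLHS]expR0 ler_expR -mulr_sumr sumrB big_const_ord iter_addr_0.
    have : m%:R * t <= m%:R * emp_dev f m w by rewrite ler_pM2l.
    rewrite /emp_dev -/mu mulrBr mulrA divff ?gt_eqF// mul1r => tm.
    rewrite -[mu *+ m]mulr_natl.
    have := ler_wpM2l (ltW s0) tm; lra.
rewrite ge0_integralZl//; last 2 first.
- apply/measurable_EFinP; apply: measurable_prod => i _.
  exact: measurableT_comp.
- by move=> w _; rewrite lee_fin prodr_ge0// => i _; exact: expR_ge0.
rewrite (@iid_integral_prod _ _ _ _ _ _ _ _ mZ iid m (fun=> h) (fun=> \int[P]_x h x))//; last 2 first.
- by move=> _ x; exact: expR_ge0.
- by move=> _; exact: EFin_Rintegral.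
rewrite -EFinM lee_fin big_const_ord iter_mulr_1.
have hle : \int[P]_x h x <= expR ((s * b) ^+ 2) by apply: (mgf_bound P mf fab) => //; exact: ltW.
have h0 : 0 <= \int[P]_x h x by apply: Rintegral_ge0 => // x _; exact: expR_ge0.
apply: (@le_trans _ _ (expR (- (s * m%:R * t)) * expR ((s * b) ^+ 2) ^+ m)).
  by rewrite ler_wpM2l ?expR_ge0// lerXn2r// nnegrE// expR_ge0.
rewrite -expRM_natl -expRD ler_expR sbE /s.
by rewrite le_eqVlt; apply/orP; left; apply/eqP; field; lra.
Qed.

Lemma emp_devN f m w : P.-integrable setT (EFin \o f) ->
  emp_dev (fun x => - f x) m w = - emp_dev f m w.
Proof.
move=> fi; rewrite /emp_dev sumrN mulrN opprB addrC; congr (_ - _).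
have := @RintegralZl _ _ _ P setT f (-1) measurableT fi.
under eq_Rintegral do rewrite mulN1r.
by rewrite mulN1r => ->; rewrite opprK.
Qed.

Lemma hoeffding (f : T -> R) (a b t : R) m :
  measurable_fun setT f -> (forall x, a <= f x <= a + b) ->
  (0 < m)%N -> 0 < t -> 2 * t <= b ->
  (Pr [set w | (t <= `|emp_dev f m w|)%R] <=
     (2 * expR (- (m%:R * t ^+ 2 / (4 * b ^+ 2))))%:E)%E.
Proof.
move=> mf fab m0 t0 tb.
have fi : P.-integrable setT (EFin \o f).
  by apply: (@integrable_bounded _ _ _ _ (`|a| + `|a + b|)) => // x; exact: normr_itv_bound.
have mS g : measurable_fun setT g -> measurable [set w | t <= emp_dev g m w].
  move=> mg; rewrite -[X in measurable X]setTI.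
  by apply: measurable_fun_le => //; exact: measurable_emp_dev.
have -> : [set w | t <= `|emp_dev f m w|] =
    [set w | t <= emp_dev f m w] `|` [set w | t <= emp_dev (fun x => - f x) m w].
  apply/seteqP; split => w /=; rewrite emp_devN// ler_normr; first by case/orP; [left|right].
  by move=> [|] ->; rewrite ?orbT.
apply: le_trans (measureU2 _ _ _) _; [exact: mS|by apply: mS; exact: measurable_funN|].
rewrite mulr_natl mulr2n EFinD leeD//; first exact: (emp_dev_upper_tail mf fab).
apply: (@emp_dev_upper_tail (fun x => - f x) (- (a + b)) b) => //.
  exact: measurable_funN.
by move=> x; have := fab x; lra.
Qed.

End tail.
End hoeffding.
(** * Density of continuous functions in L1 *)

Section density.
Import HBNNSimple.
Context {R : realType} {X : pseudoPMetricType R} (P : probability (borelT X * bool)%type R).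

Lemma L1_small_of_cvg0 d (T : measurableType d) (mu : probability T R) (u : nat -> T -> R) (B : R) :
  (forall n, measurable_fun setT (u n)) -> (forall n x, `|u n x| <= B) ->
  (forall x, u n x @[n --> \oo] --> (0 : R)) ->
  forall e : R, 0 < e -> exists n, (\int[mu]_x (`|u n x|)%:E <= e%:E)%E.
Proof.
move=> mu_ uB u0 e e0.
have B0 : 0 <= B by apply: le_trans (uB 0%N point).
have mu' n : measurable_fun setT (fun x => (`|u n x|)%:E).
  by apply/measurable_EFinP; exact: measurableT_comp.
have cvg0 : {ae mu, forall x, setT x -> (`|u n x|)%:E @[n --> \oo] --> cst 0%E x}.
  apply: aeW => x _; apply/cvg_EFin; first by apply: nearW.
  apply/cvgrPdist_le => r r0; move/cvgrPdist_le : (u0 x) => /(_ r r0).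
  by apply: filterS => n; rewrite /= !sub0r !normrN normr_id.
have dom : {ae mu, forall x n, setT x -> (`| (`|u n x|)%:E | <= cst B%:E x)%E}.
  by apply: aeW => x n _; rewrite /= normr_id lee_fin.
have iB : mu.-integrable setT (cst B%:E) by exact: (@integrable_bounded _ _ _ _ (cst B) `|B|).
have : (\int[mu]_x (`|u n x|)%:E)%E @[n --> \oo] --> 0%E.
  rewrite -(integral0 mu setT).
  by have [] := dominated_convergence measurableT mu' (measurable_cst _) cvg0 iB dom.
move/fine_cvgP => [fin /cvgrPdist_le/(_ e e0)] /(filterI fin)[n _ /(_ n (leqnn n))[/= nfin]].
rewrite sub0r normrN => /(le_trans (ler_norm _)) ?; exists n.
by rewrite -[leLHS]fineK.
Qed.

(** Approximability in L1 of the [X]-marginal of [P]; integrating over pairs avoids introducing the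
    marginal. Measurability is bundled so that the closure lemmas carry it along. *)
Definition L1_approximable (g : borelT X -> R) :=
  measurable_fun setT g /\ forall e : R, 0 < e ->
    exists2 h : X -> R, continuous h & (\int[P]_z (`|g z.1 - h z.1|)%:E <= e%:E)%E.

Lemma measurable_comp_fst (g : borelT X -> R) : measurable_fun setT g ->
  measurable_fun [set: borelT X * bool] (fun z => g z.1).
Proof. by move=> mg; exact: measurableT_comp. Qed.

Lemma measurable_absB (g h : borelT X -> R) :
  measurable_fun setT g -> measurable_fun setT h ->
  measurable_fun [set: borelT X * bool] (fun z => (`|g z.1 - h z.1|)%:E).
Proof.
move=> mg mh; apply/measurable_EFinP; apply: measurableT_comp => //.
by apply: measurable_funB; exact: measurable_comp_fst.
Qed.

Lemma L1_dist_triangle (g h k : borelT X -> R) : measurable_fun setT g ->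
  measurable_fun setT h -> measurable_fun setT k ->
  (\int[P]_z (`|g z.1 - k z.1|)%:E <=
   \int[P]_z (`|g z.1 - h z.1|)%:E + \int[P]_z (`|h z.1 - k z.1|)%:E)%E.
Proof.
move=> mg mh mk; rewrite -ge0_integralD//; try exact: measurable_absB.
apply: ge0_le_integral => //; first exact: measurable_absB.
- by apply: emeasurable_funD; exact: measurable_absB.
- by move=> z _; rewrite -EFinD lee_fin ler_distD.
Qed.

Lemma L1_approximable_closed (g : borelT X -> R) : measurable_fun setT g ->
  (forall e : R, 0 < e -> exists2 h, L1_approximable h &
     (\int[P]_z (`|g z.1 - h z.1|)%:E <= e%:E)%E) -> L1_approximable g.
Proof.
move=> mg ga; split=> // e e0; have e20 : 0 < e / 2 by rewrite divr_gt0.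
have [h [mh ha] gh] := ga _ e20; have [k kc hk] := ha _ e20.
exists k => //; apply: le_trans (L1_dist_triangle mg mh (continuous_borelT kc)) _.
by rewrite [e]splitr EFinD leeD.
Qed.

(** Dominated convergence by a constant. It serves three times: for open sets, for disjoint unions
    and for simple approximations. *)
Lemma L1_approximable_limit (u : nat -> borelT X -> R) (g : borelT X -> R) (B : R) :
  (forall n, L1_approximable (u n)) -> measurable_fun setT g ->
  (forall n x, `|g x - u n x| <= B) -> (forall x, u n x @[n --> \oo] --> g x) ->
  L1_approximable g.
Proof.
move=> ua mg uB ug; apply: L1_approximable_closed => // e e0.
have [|||n nP] := @L1_small_of_cvg0 _ _ P (fun n z => g z.1 - u n z.1) B _ _ _ _ e0.
- by move=> n; apply: measurable_funB; apply: measurable_comp_fst => //; case: (ua n).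
- by move=> n z; exact: uB.
- by move=> z; rewrite -(subrr (g z.1)); apply: cvgB; [exact: cvg_cst|exact: ug].
- by exists (u n).
Qed.

Lemma L1_approximable_continuous (h : X -> R) : continuous h -> L1_approximable h.
Proof.
move=> hc; split; first exact: continuous_borelT.
move=> e e0; exists h => //; under eq_integral do rewrite subrr normr0.
by rewrite integral0 lee_fin ltW.
Qed.

Lemma L1_approximableD (g1 g2 : borelT X -> R) : L1_approximable g1 ->
  L1_approximable g2 -> L1_approximable (fun x => g1 x + g2 x).
Proof.
move=> [mg1 a1] [mg2 a2]; split; first exact: measurable_funD.
move=> e e0; have e20 : 0 < e / 2 by rewrite divr_gt0.
have [h1 c1 l1] := a1 _ e20; have [h2 c2 l2] := a2 _ e20.
have mh1 := continuous_borelT c1; have mh2 := continuous_borelT c2.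
exists (fun x => h1 x + h2 x); first by move=> x; apply: cvgD; [exact: c1|exact: c2].
apply: (@le_trans _ _ (\int[P]_z (`|g1 z.1 - h1 z.1|)%:E +
    \int[P]_z (`|g2 z.1 - h2 z.1|)%:E)%E); last by rewrite [e]splitr EFinD leeD.
rewrite -ge0_integralD//; try exact: measurable_absB.
apply: ge0_le_integral => //.
- by apply: (@measurable_absB (fun x => g1 x + g2 x) (fun x => h1 x + h2 x)); exact: measurable_funD.
- by apply: emeasurable_funD; exact: measurable_absB.
- by move=> z _; rewrite -EFinD lee_fin opprD addrACA ler_normD.
Qed.

Lemma L1_approximableZ (a : R) (g : borelT X -> R) : L1_approximable g ->
  L1_approximable (fun x => a * g x).
Proof.
move=> [mg ga]; split; first exact: measurable_funM.
(* Adding 1 keeps the division safe when [a = 0]. *)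
move=> e e0; have a0 : 0 < `|a| + 1 by rewrite ltr_pwDr.
have [h hc gh] := ga _ (divr_gt0 e0 a0).
exists (fun x => a * h x); first by move=> x; apply: cvgM; [exact: cvg_cst|exact: hc].
have mh := continuous_borelT hc.
under eq_integral do rewrite -mulrBr normrM EFinM.
rewrite ge0_integralZl//; last exact: measurable_absB.
apply: (@le_trans _ _ (`|a|%:E * (e / (`|a| + 1))%:E)%E); first exact: lee_wpmul2l.
rewrite -EFinM lee_fin mulrCA ger_pMr// ler_pdivrMr// mul1r.
by rewrite lerDl.
Qed.

Lemma L1_approximable_sum (I : Type) (s : seq I) (g : I -> borelT X -> R) :
  (forall i, L1_approximable (g i)) -> L1_approximable (fun x => \sum_(i <- s) g i x).
Proof.
move=> ga; elim: s => [|i s IH].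
  under eq_fun do rewrite big_nil.
  by apply: (@L1_approximable_continuous (cst 0)); exact: cst_continuous.
under eq_fun do rewrite big_cons.
exact: L1_approximableD.
Qed.

(* An open set [O] is the increasing union of the sets of points whose
   [n.+1^-1]-ball lies in [O], and these are uniformly separated from [~` O]. *)
Lemma L1_approximable_open (O : set X) : open O -> L1_approximable (\1_O : borelT X -> R).
Proof.
move=> Oo; pose A n := [set x : X | ball x n.+1%:R^-1 `<=` O].
have sep n : uniform_separator (A n) (~` O).
  apply: uniform_separatorW; exists [set p : X * X | ball p.1 n.+1%:R^-1 p.2].
    have n0 : 0 < n.+1%:R^-1 :> R by rewrite invr_gt0.
    exact: (entourage_ball X (PosNum n0)).
  by rewrite -subset0 => -[x y] /= [[Ax Oy]] /Ax.
(* [Urysohn] is 0 on its first set and 1 on its second, hence the complement to 1. *)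
pose h n : X -> R := fun x => 1 - @Urysohn X R (A n) (~` O) x.
have hA n x : A n x -> h n x = 1.
  move=> Ax; have /(_ (Urysohn (A n) (~` O) x)) := @Urysohn_sub0 X R _ _ (sep n).
  by rewrite /h => ->; [rewrite subr0|exists x].
have hO n x : ~ O x -> h n x = 0.
  move=> Ox; have /(_ (Urysohn (A n) (~` O) x)) := @Urysohn_sub1 X R _ _ (sep n).
  by rewrite /h => ->; [rewrite subrr|exists x].
have h01 n x : 0 <= h n x <= 1.
  have /(_ (Urysohn (A n) (~` O) x)) := @Urysohn_range X R (A n) (~` O).
  by rewrite /h /= in_itv /= => /(_ _)/wrap[]; [exists x|lra].
apply: (@L1_approximable_limit h _ 1).
- move=> n; apply: L1_approximable_continuous => x.
  by apply: cvgB; [exact: cvg_cst|exact: Urysohn_continuous].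
- by apply: measurable_indic; exact: sub_sigma_algebra.
- move=> n x; rewrite indicE; have := h01 n x.
  by case: (x \in O) => /=; rewrite ler_norml; lra.
- move=> x; rewrite indicE; have [Ox|Ox] := pselect (O x); last first.
    rewrite memNset// (_ : h ^~ x = cst 0); first exact: cvg_cst.
    by apply/funext => n; exact: hO.
  rewrite mem_set//; apply: cvg_near_cst.
  have /nbhs_ballP[r /= r0 rO] : nbhs x O by rewrite nbhsE; exists O.
  have := @near_infty_natSinv_lt R (PosNum r0); apply: filterS => n /= nr.
  by apply: hA => y /= /(le_ball (ltW nr)) /rO.
Qed.

(** Pi-lambda argument: the open sets are stable under intersection and generate the Borel sets, and
    the sets with approximable indicator form a Dynkin system. *)
Lemma L1_approximable_indic (A : set (borelT X)) : measurable A ->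
  L1_approximable (\1_A : borelT X -> R).
Proof.
pose D := [set A : set (borelT X) | measurable A /\ L1_approximable (\1_A : borelT X -> R)].
move=> mA; suff : D A by case.
have DD : dynkin D.
  split.
  - split => //; rewrite indicT.
    by apply: (@L1_approximable_continuous (cst 1)); exact: cst_continuous.
  - move=> B [mB Ba]; split; first exact: measurableC.
    rewrite (_ : \1_(~` B) = fun x => 1 + (-1) * \1_B x); last first.
      by apply/funext => x; rewrite indicC indicE; case: (x \in B) => /=; lra.
    apply: L1_approximableD; last exact: L1_approximableZ.
    by apply: (@L1_approximable_continuous (cst 1)); exact: cst_continuous.
  - move=> F tF FD.
    have mF n : measurable (F n) by case: (FD n).
    split; first exact: bigcupT_measurable.
    (* Disjointness makes the partial sums indicators, hence bounded by 1 as the limit lemma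
       requires. *)
    have sumE n x : \sum_(i < n) (\1_(F i) x : R) = \1_(\bigcup_(i < n) F i) x.
      elim: n => [|n IH]; first by rewrite big_ord0 bigcup_mkord big_ord0 indicE in_set0.
      rewrite big_ord_recr /= IH !bigcup_mkord big_ord_recr /= -bigcup_mkord !indicE in_setU.
      case: (boolP (x \in F n)) => [/set_mem Fnx|_]; last by rewrite orbF addr0.
      rewrite memNset ?add0r// => -[i /= ilt Fix].
      by have /trivIsetP/(_ i n Logic.I Logic.I) := tF; rewrite ltn_eqF// => /(_ isT) Fin;
        have : (F i `&` F n) x by []; rewrite Fin.
    apply: (@L1_approximable_limit (fun n x => \sum_(i < n) \1_(F i) x) _ 1).
    + by move=> n; apply: L1_approximable_sum => i; case: (FD i).
    + by apply: measurable_indic; exact: bigcupT_measurable.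
    + move=> n x; rewrite sumE !indicE.
      by do 2 case: (_ \in _); rewrite /= ?subrr ?subr0 ?sub0r ?normrN ?normr1 ?normr0.
    + move=> x; under eq_fun do rewrite sumE.
      rewrite !indicE; have [[i _ Fix]|nF] := pselect ((\bigcup_i F i) x); last first.
        rewrite memNset//; apply: cvg_near_cst; apply: nearW => n.
        by rewrite indicE memNset// => -[i _ Fi]; apply: nF; exists i.
      rewrite mem_set; last by exists i.
      apply: cvg_near_cst; exists i.+1 => // n /= ni.
      by rewrite indicE mem_set//; exists i.
have /lambda_system_subset := (dynkin_lambda_system D).1 DD.
move=> /(_ open); apply => //.
- by move=> U V; exact: openI.
- by move=> U Uo; split; [exact: sub_sigma_algebra|exact: L1_approximable_open].
Qed.

Lemma L1_approximable_bounded (g : borelT X -> R) (B : R) : measurable_fun setT g ->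
  (forall x, `|g x| <= B) -> L1_approximable g.
Proof.
move=> mg gB.
(* The shift makes the function nonnegative, so that increasing simple functions converge to it, at
   distance at most [2 * B]. *)
pose g' x := g x + B.
have g'0 x : 0 <= g' x by have := gB x; rewrite ler_norml /g'; lra.
have mg' : measurable_fun setT g' by exact: measurable_funD.
have g'E : g = fun x => g' x + (- B) by apply/funext => x; rewrite /g' addrK.
rewrite g'E; apply: L1_approximableD; last first.
  by apply: (@L1_approximable_continuous (cst (- B))); exact: cst_continuous.
have mEg : measurable_fun setT (EFin \o g') by exact/measurable_EFinP.
pose u := nnsfun_approx measurableT mEg.
have ucvg x : u n x @[n --> \oo] --> g' x.
  have /fine_cvgP[_] : EFin \o u^~ x @ \oo --> (g' x)%:E.
    by apply: (@cvg_nnsfun_approx _ _ _ _ measurableT _ mEg) => // y _; rewrite lee_fin.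
  exact.
have uD x : {homo u^~ x : m n / (m <= n)%N >-> m <= n}.
  by move=> m n mn; exact/lefP/nd_nnsfun_approx.
have ug n x : u n x <= g' x.
  have := @nondecreasing_cvgn_le _ _ (uD x) _ n; rewrite (cvg_lim _ (ucvg x))//.
  by apply; exact: ucvg.
apply: (@L1_approximable_limit (fun n => u n) _ (2 * B)) => //.
- move=> n; rewrite (_ : (u n : _ -> _) = fun x => \sum_(y <- finmap.enum_fset (fset_set (range (u n)))) (y * \1_(u n @^-1` [set y]) x)).
    apply: L1_approximable_sum => y; apply: L1_approximableZ.
    by apply: L1_approximable_indic; exact: measurable_sfunP.
  by apply/funext => x; rewrite [LHS]fimfunE fsbig_finite.
- move=> n x; have := ug n x; have : 0 <= u n x by [].
  by have := gB x; rewrite /g' !ler_norml; lra.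
Qed.

Definition clamp (B x : R) : R := Num.max (- B) (Num.min B x).

Lemma normr_clamp (B x : R) : 0 <= B -> `|clamp B x| <= B.
Proof. by move=> B0; rewrite /clamp ler_norml le_max lexx /= ge_max ge_min lexx /=; lra. Qed.

Lemma continuous_clamp (T : topologicalType) (h : T -> R) (B : R) : 0 <= B -> continuous h ->
  continuous (fun x => clamp B (h x)).
Proof.
move=> B0 hc x; apply/cvgrPdist_lt => e e0.
move: (hc x) => /cvgrPdist_lt/(_ e e0); apply: filterS => y; apply: le_lt_trans; rewrite /clamp.
move: (h x) (h y) => a b.
have l1 := ler_norm (a - b); have l2 := ler_norm (- (a - b)); rewrite normrN in l2.
by case: (leP B a) => ?; case: (leP B b) => ?; case: (leP (- B) a) => ?;
  case: (leP (- B) b) => ?; case: (leP (- B) B) => ?; rewrite ler_norml; lra.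
Qed.

(** Clamping the approximant fixes the values of [g] and never moves it away from them. The common
    bound keeps the loss on an interval where it is Lipschitz. *)
Lemma bounded_L1_density (g : borelT X -> R) (B : R) : measurable_fun setT g ->
  (forall x, `|g x| <= B) -> forall e : R, 0 < e ->
  exists h : X -> R, [/\ continuous h, forall x, `|h x| <= B &
    (\int[P]_z (`|g z.1 - h z.1|)%:E <= e%:E)%E].
Proof.
move=> mg gB e e0; have [_ /(_ e e0)[h hc gh]] := L1_approximable_bounded mg gB.
have B0 : 0 <= B by apply: le_trans (gB point).
exists (fun x => clamp B (h x)); split.
- exact: continuous_clamp.
- by move=> x; exact: normr_clamp.
- apply: le_trans gh; apply: ge0_le_integral => //.
  + apply: (@measurable_absB g (fun x => clamp B (h x))) => //.
    by apply: continuous_borelT; exact: continuous_clamp.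
  + by apply: measurable_absB => //; exact: continuous_borelT.
  + move=> z _; rewrite lee_fin; have := gB z.1; rewrite ler_norml => gBz.
    move: (g z.1) (h z.1) gBz => a b gBz; rewrite /clamp.
    have l1 := ler_norm (a - b); have l2 := ler_norm (- (a - b)); rewrite normrN in l2.
    by case: (leP B b) => ?; case: (leP (- B) b) => ?; case: (leP (- B) B) => ?;
      rewrite ler_norml; lra.
Qed.

End density.
(** * The convex loss and its risk *)

Section convex_loss.
Context {R : realType} {l : R -> R}.
Hypothesis l_convex : loss_convex l.

Lemma convex_slope_le u z w : u < z -> z < w ->
  (l z - l u) / (z - u) <= (l w - l z) / (w - z).
Proof.
move=> uz zw; rewrite ler_pdivrMr ?subr_gt0// mulrAC ler_pdivlMr ?subr_gt0//.
have wu : 0 < w - u by lra.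
(* The weight that writes [z] as a convex combination of [u] and [w]. *)
have t01 : 0 <= (w - z) / (w - u) <= 1.
  by rewrite ler_pdivlMr// ler_pdivrMr//; lra.
have := l_convex u w t01.
have -> : (w - z) / (w - u) * u + (1 - (w - z) / (w - u)) * w = z by field; lra.
rewrite -(ler_pM2r wu).
have -> : ((w - z) / (w - u) * l u + (1 - (w - z) / (w - u)) * l w) * (w - u) =
  (w - z) * l u + (z - u) * l w by field; lra.
lra.
Qed.

(** The supremum of the left slopes at [z] is a subgradient: by [convex_slope_le] every right slope
    bounds it from above. *)
Lemma subdiff_nonempty z : exists g, subdiff l z g.
Proof.
pose S := [set (l z - l u) / (z - u) | u in [set u | u < z]].
have ubS w : z < w -> ubound S ((l w - l z) / (w - z)).
  by move=> zw _ [u /= uz <-]; exact: convex_slope_le.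
have supS : has_sup S.
  split; first by exists ((l z - l (z - 1)) / (z - (z - 1))), (z - 1) => //=; lra.
  by exists ((l (z + 1) - l z) / (z + 1 - z)); apply: ubS; lra.
exists (sup S) => w; have [wz|zw|->] := ltgtP w z; last by rewrite subrr mulr0 addr0.
- have : (l z - l w) / (z - w) <= sup S by apply: ub_le_sup; [case: supS|exists w].
  by rewrite ler_pdivrMr ?subr_gt0//; lra.
- have : sup S <= (l w - l z) / (w - z) by apply: ge_sup; [case: supS|exact: ubS].
  by rewrite ler_pdivlMr ?subr_gt0//; lra.
Qed.

Hypothesis l_nondecr : loss_nondecr l.
Hypothesis l_ge0 : forall z, 0 <= l z.

(** A subgradient [g] at [v <= N] satisfies [g <= l (v + 1) - l v <= l (N + 1)], and it controls the
    increase of [l] from any [u <= v]. *)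
Lemma loss_lipschitz (N : R) : loss_lipschitz_on l (- N) N (l (N + 1)).
Proof.
suff h u v : u <= v -> v <= N -> l v - l u <= l (N + 1) * (v - u).
  move=> u v /andP[_ uN] /andP[_ vN]; have [uv|/ltW vu] := leP u v.
    by rewrite distrC [`|u - v|]distrC !ger0_norm ?subr_ge0// ?h// l_nondecr.
  by rewrite !ger0_norm ?subr_ge0// ?h// l_nondecr.
move=> uv vN; have [g gv] := subdiff_nonempty v.
have gN : g <= l (N + 1).
  have := gv (v + 1); have := @l_nondecr (v + 1) (N + 1); rewrite lerD2r => /(_ vN).
  by have := l_ge0 v; rewrite (_ : v + 1 - v = 1); lra.
have := gv u; have : g * (v - u) <= l (N + 1) * (v - u).
  by rewrite ler_wpM2r// subr_ge0.
lra.
Qed.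

(** To the right of [z0] the supporting line at [z0] has slope at least [Mg]; to its left the lower
    bound is nonpositive. *)
Lemma loss_superlinear :
  (forall Mg : R, 0 < Mg -> exists z0, forall z g, z0 <= z -> subdiff l z g -> Mg <= g) ->
  forall Mg : R, 0 < Mg -> exists z0, forall r, Mg * (r - z0) <= l r.
Proof.
move=> lsup Mg Mg0; have [z0 z0P] := lsup _ Mg0; exists z0 => r.
have [z0r|rz0] := leP z0 r; last first.
  by apply: le_trans (l_ge0 r); rewrite mulr_ge0_le0 ?(ltW Mg0)//; lra.
have [g gz0] := subdiff_nonempty z0.
have := gz0 r; have := l_ge0 z0.
have : Mg * (r - z0) <= g * (r - z0).
  by rewrite ler_wpM2r ?subr_ge0//; exact: (z0P z0 g).
lra.
Qed.

End convex_loss.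

(** * Bounds and approximation for the risk *)

Section risk.
Context {R : realType} {X : pseudoPMetricType R}
  (P : probability (borelT X * bool)%type R) (l : R -> R).
Hypothesis l_convex : loss_convex l.
Hypothesis l_nondecr : loss_nondecr l.
Hypothesis l_ge0 : forall z, 0 <= l z.

Lemma measurable_risk_integrand (g : borelT X -> R) (rho : R) : measurable_fun setT g ->
  measurable_fun [set: borelT X * bool] (fun z => (l (rho - sgnb R z.2 * g z.1))%:E).
Proof.
move=> mg; apply/measurable_EFinP.
have := @measurable_loss _ _ l g 0 rho l_nondecr mg.
by under eq_fun do rewrite addr0.
Qed.

Lemma measurable_nonpos_margin (g : borelT X -> R) : measurable_fun setT g ->
  measurable [set z : borelT X * bool | sgnb R z.2 * g z.1 <= 0].
Proof.
move=> mg; rewrite -[X in measurable X]setTI; apply: measurable_fun_le => //.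
by apply: measurable_funM; [exact: (measurableT_comp measurable_sgnb)|exact: measurableT_comp].
Qed.

Lemma measurable_noise (eps0 : R) (eta : borelT X -> R) : measurable_fun setT eta ->
  measurable [set x : borelT X | eps0 <= eta x <= 1 - eps0].
Proof.
move=> meta.
rewrite (_ : [set x | _] = [set x | eps0 <= eta x] `&` [set x | eta x <= 1 - eps0]).
  apply: measurableI; rewrite -[X in measurable X]setTI; exact: measurable_fun_le.
by apply/seteqP; split => x /= /andP.
Qed.

(** On the noisy region each label has conditional probability at least [eps0]. Whatever the sign of
    [g], one label contradicts it: [true] where [g <= 0], [false] elsewhere. *)
Lemma noise_margin (eps0 : R) (eta : borelT X -> R) (g : borelT X -> R) :
  0 < eps0 -> cond_prob_pos P eta -> measurable_fun setT g ->
  (eps0%:E * P ([set x : borelT X | (eps0 <= eta x <= 1 - eps0)%R] `*` setT) <=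
   P [set z | (sgnb R z.2 * g z.1 <= 0)%R])%E.
Proof.
move=> e0 [meta eta01 etaP] mg; set A := [set x : borelT X | _].
have mA : measurable A by exact: measurable_noise.
have mle : measurable [set x : borelT X | g x <= 0].
  by rewrite -[X in measurable X]setTI; exact: measurable_fun_le.
have label B : measurable B -> B `<=` A ->
    (eps0%:E * P (B `*` setT) <= P (B `*` [set true]))%E /\
    (P (B `*` [set true]) <= (1 - eps0)%:E * P (B `*` setT))%E.
  move=> mB BA; have mBT : measurable (B `*` [set: bool]) by exact: measurableX.
  have mE : measurable_fun (B `*` [set: bool]) (fun z : borelT X * bool => (eta z.1)%:E).
    by apply: measurable_funTS; apply/measurable_EFinP; exact: measurableT_comp.
  rewrite etaP// -!integral_cst//; split; apply: ge0_le_integral => //.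
  - by move=> z _; rewrite lee_fin ltW.
  - by move=> z [/BA /andP[+ _] _]; rewrite lee_fin.
  - by move=> z _; rewrite lee_fin; case/andP : (eta01 z.1).
  - by move=> z [/BA /andP[_ +] _]; rewrite lee_fin.
pose B1 := A `&` [set x | g x <= 0]; pose B2 := A `\` [set x | g x <= 0].
have mB1 : measurable B1 by exact: measurableI.
have mB2 : measurable B2 by exact: measurableD.
have mX B (C : set bool) : measurable B -> measurable (B `*` C).
  by move=> mB; exact: measurableX.
have AE : A `*` [set: bool] = (B1 `*` setT) `|` (B2 `*` setT).
  apply/seteqP; split=> [[x b] [/= Ax _]|[x b] [[[/= Ax _] _]|[[/= Ax _] _]]] //.
  by have [gx|gx] := pselect (g x <= 0); [left|right].
have B12 : (B1 `*` [set: bool]) `&` (B2 `*` [set: bool]) = set0.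
  by rewrite -subset0 => -[x b] [[[_ gx] _] [[_]]].
(* [eta] describes the label [true] only, so the mass of [false] comes by subtraction from the upper
   bound [1 - eps0]. *)
have false_label B : measurable B -> B `<=` A ->
    (eps0%:E * P (B `*` setT) <= P (B `*` [set false]))%E.
  move=> mB BA; have [_] := label B mB BA.
  have -> : P (B `*` [set: bool]) = (P (B `*` [set true]) + P (B `*` [set false]))%E.
    rewrite -measureU; [|exact: mX|exact: mX|].
    - by congr (P _); apply/seteqP; split=> [[x []] [/= Bx _]|[x b] [[]|[]]] //; [left|right].
    - by rewrite -subset0 => -[x b] [[_ /= ->] []].
  rewrite -(fineK (fin_num_measure P _ (mX _ _ _ [set true] mB))).
  rewrite -(fineK (fin_num_measure P _ (mX _ _ _ [set false] mB))).
  by rewrite -EFinD -!EFinM !lee_fin; lra.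
rewrite AE measureU//; [|exact: mX|exact: mX].
rewrite ge0_muleDr//.
apply: le_trans (leeD (label B1 mB1 _).1 (false_label B2 mB2 _)) _; [by move=> ? []..|].
rewrite -measureU; [|exact: mX|exact: mX|]; last first.
  by rewrite -subset0 => -[x b] [[_ /= ->] []].
apply: le_measure; rewrite ?inE.
- by apply: measurableU; exact: mX.
- exact: measurable_nonpos_margin.
- move=> [x b] [[[/= _ gx] ->]|[[/= _ /negP gx] ->]]; rewrite /sgnb ?mul1r//.
  by move: gx; rewrite -ltNge => /ltW; lra.
Qed.

Lemma risk_bounded_below (eps0 : R) (eta : borelT X -> R) :
  (forall Mg : R, 0 < Mg -> exists z0, forall z g, z0 <= z -> subdiff l z g -> Mg <= g) ->
  0 < eps0 -> cond_prob_pos P eta ->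
  (0 < P ([set x : borelT X | (eps0 <= eta x <= 1 - eps0)%R] `*` setT))%E ->
  exists B : R, forall (g : borelT X -> R) rho, measurable_fun setT g ->
    (B%:E <= risk P l g rho)%E.
Proof.
move=> lsup e0 etaP P0; set A := (_ `*` setT) in P0.
have mA : measurable A by apply: measurableX => //; case: etaP => meta _ _; exact: measurable_noise.
pose q := eps0 * fine (P A).
have q0 : 0 < q.
  by rewrite mulr_gt0// fine_gt0// P0/= ltey_eq fin_num_measure.
(* With slope [2 / q], [q * l rho >= 2 * (rho - z0)] cancels the term [- 2 * rho]. *)
have [z0 z0P] := loss_superlinear l_convex l_ge0 lsup (divr_gt0 (@ltr0Sn R 1) q0).
exists (- (2 * z0)) => g rho mg.
have mS := measurable_nonpos_margin mg.
have : (q%:E <= P [set z | (sgnb R z.2 * g z.1 <= 0)%R])%E.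
  apply: le_trans (noise_margin e0 etaP mg).
  by rewrite /q EFinM fineK// fin_num_measure.
move=> qP.
have : ((l rho * q)%:E <= \int[P]_z (l (rho - sgnb R z.2 * g z.1))%:E)%E.
  apply: (@le_trans _ _ (\int[P]_z ((l rho)%:E * (\1_[set z | sgnb R z.2 * g z.1 <= 0] z)%:E))%E).
    rewrite ge0_integralZl//; [|exact/measurable_EFinP/measurable_indic|by rewrite lee_fin].
    by rewrite integral_indic// setIT EFinM lee_wpmul2l// lee_fin.
  apply: ge0_le_integral => //.
  - by move=> z _; rewrite mule_ge0 ?lee_fin.
  - by apply: measurable_funeM; exact/measurable_EFinP/measurable_indic.
  - exact: measurable_risk_integrand.
  - move=> z _; rewrite -EFinM lee_fin indicE.
    case: (boolP (z \in _)) => [/set_mem /= z0'|_]; rewrite ?mulr1 ?mulr0//.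
    by apply: l_nondecr; lra.
move=> h; rewrite /risk; apply: le_trans (leeD (lexx _) h).
rewrite -EFinD lee_fin.
have := z0P rho; rewrite -(ler_pM2r q0).
have -> : 2 / q * (rho - z0) * q = 2 * (rho - z0) by field; lra.
lra.
Qed.

Lemma risk_le_add (g g' : borelT X -> R) (v : borelT X * bool -> R) (rho e : R) :
  measurable_fun setT g -> measurable_fun setT g' -> measurable_fun setT v ->
  (forall z, 0 <= v z) -> (\int[P]_z (v z)%:E <= e%:E)%E ->
  (forall z, l (rho - sgnb R z.2 * g' z.1) <= l (rho - sgnb R z.2 * g z.1) + v z) ->
  (risk P l g' rho <= risk P l g rho + e%:E)%E.
Proof.
move=> mg mg' mv v0 ve gg'; rewrite /risk -addeA leeD2l//.
apply: (@le_trans _ _ (\int[P]_z (l (rho - sgnb R z.2 * g z.1))%:E + \int[P]_z (v z)%:E)%E).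
  rewrite -ge0_integralD//; [|by move=> z _; rewrite lee_fin..|exact: measurable_risk_integrand|by move=> z _; rewrite lee_fin|exact/measurable_EFinP].
  apply: ge0_le_integral => //.
  - by move=> z _; rewrite lee_fin.
  - exact: measurable_risk_integrand.
  - by apply: emeasurable_funD; [exact: measurable_risk_integrand|exact/measurable_EFinP].
  - by move=> z _; rewrite -EFinD lee_fin.
by rewrite leeD2l.
Qed.

Lemma risk_le_L1 (g g' : borelT X -> R) (B rho e : R) :
  measurable_fun setT g -> measurable_fun setT g' ->
  (forall x, `|g x| <= B) -> (forall x, `|g' x| <= B) ->
  (\int[P]_z (`|g z.1 - g' z.1|)%:E <= e%:E)%E ->
  (risk P l g' rho <= risk P l g rho + (l (`|rho| + B + 1) * e)%:E)%E.
Proof.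
move=> mg mg' gB g'B gg'; set kap := l _.
apply: (@risk_le_add _ _ (fun z => kap * `|g z.1 - g' z.1|)) => //.
- apply: measurable_funM => //; apply: measurableT_comp => //.
  by apply: measurable_funB; exact: measurable_comp_fst.
- by move=> z; rewrite mulr_ge0 ?l_ge0.
- under eq_integral do rewrite EFinM.
  rewrite ge0_integralZl//; [|exact: measurable_absB|by rewrite lee_fin l_ge0].
  by rewrite EFinM lee_wpmul2l// lee_fin l_ge0.
- move=> z; have lip := @loss_lipschitz _ _ l_convex l_nondecr l_ge0 (`|rho| + B).
  have argB (h : borelT X -> R) : (forall x, `|h x| <= B) ->
      - (`|rho| + B) <= rho - sgnb R z.2 * h z.1 <= `|rho| + B.
    move=> hB; rewrite -ler_norml (le_trans (ler_normB _ _))// lerD2l normrM.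
    by rewrite (_ : `|sgnb R z.2| = 1) ?mul1r//; case: z.2; rewrite /sgnb ?normrN normr1.
  have := lip _ _ (argB _ g'B) (argB _ gB); rewrite -/kap.
  have -> : `|rho - sgnb R z.2 * g' z.1 - (rho - sgnb R z.2 * g z.1)| = `|g z.1 - g' z.1|.
    rewrite (_ : _ - _ - _ = sgnb R z.2 * (g z.1 - g' z.1)); last by ring.
    by rewrite normrM (_ : `|sgnb R z.2| = 1) ?mul1r//; case: z.2; rewrite /sgnb ?normrN normr1.
  by have := ler_norm (l (rho - sgnb R z.2 * g' z.1) - l (rho - sgnb R z.2 * g z.1)); lra.
Qed.

Lemma clamp_id (B x : R) : `|x| <= B -> clamp B x = x.
Proof.
rewrite ler_norml /clamp => xB.
by case: (leP B x) => ?; case: (leP (- B) x) => ?; case: (leP (- B) B) => ?; lra.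
Qed.

(* Truncation never increases the loss where the margin is negative, and bounds
   it by [l rho] where the margin is positive. *)
Lemma truncated_loss (B x rho : R) y : 0 <= B ->
  l (rho - sgnb R y * clamp B x) <= l (rho - sgnb R y * x) + l rho.
Proof.
move=> B0; have lr := l_ge0 rho; have lx := l_ge0 (rho - sgnb R y * x).
have [yx|yx] := leP (sgnb R y * x) 0.
  apply: (@le_trans _ _ (l (rho - sgnb R y * x))); last by lra.
  apply: l_nondecr; move: yx; rewrite /sgnb /clamp.
  by case: y {lx}; case: (leP B x) => ?; case: (leP (- B) x) => ?;
    case: (leP (- B) B) => ?; lra.
apply: (@le_trans _ _ (l rho)); last by lra.
apply: l_nondecr; move: yx; rewrite /sgnb /clamp.
by case: y {lx}; case: (leP B x) => ?; case: (leP (- B) x) => ?;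
  case: (leP (- B) B) => ?; lra.
Qed.

Lemma risk_truncation (g : borelT X -> R) (rho e : R) : measurable_fun setT g -> 0 < e ->
  exists2 B : R, 0 <= B & (risk P l (fun x => clamp B (g x)) rho <= risk P l g rho + e%:E)%E.
Proof.
move=> mg e0.
have mset n : measurable [set z : borelT X * bool | `|g z.1| <= n%:R].
  rewrite -[X in measurable X]setTI; apply: measurable_fun_le => //.
  by apply: measurableT_comp => //; exact: measurable_comp_fst.
(* The cost of truncating at level [n]. At each [z] it vanishes once [n] exceeds [|g z.1|], so its
   integral becomes small. *)
pose v n (z : borelT X * bool) := l rho * \1_(~` [set z | `|g z.1| <= n%:R]) z.
have mv n : measurable_fun setT (v n).
  by apply: measurable_funM => //; apply: measurable_indic; exact: measurableC.
have v0 n z : 0 <= v n z by rewrite mulr_ge0.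
have [|||n vn] := @L1_small_of_cvg0 _ _ _ P v (l rho) _ _ _ e e0 => //.
- by move=> n z; rewrite ger0_norm// ler_piMr// indicE; case: (_ \in _).
- move=> z; apply: cvg_near_cst.
  have : \forall n \near \oo, `|g z.1| <= n%:R by exact: nbhs_infty_ger.
  by apply: filterS => n ng; rewrite /v indicE memNset ?mulr0//; apply.
exists n%:R => //; apply: (@risk_le_add _ _ (v n)) => //.
- by apply: measurable_maxr => //; exact: measurable_minr.
- by apply: le_trans vn; under eq_integral do rewrite -[v n _]ger0_norm//.
- move=> z; rewrite /v indicC; case: (boolP (z \in _)) => [/set_mem /= zn|zn].
    by rewrite mulr0 addr0 clamp_id.
  by rewrite mulr1 truncated_loss.
Qed.

Lemma universal_risk_approx (H : set (X -> R)) : universal_rkhs H ->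
  (forall f, H f -> measurable_fun setT (f : borelT X -> R)) ->
  forall (g : borelT X -> R) (rho e : R), measurable_fun setT g -> 0 < e ->
  exists2 f, H f & (risk P l f rho <= risk P l g rho + e%:E)%E.
Proof.
move=> univ mH g rho e mg e0.
have e3 : 0 < e / 3 by rewrite divr_gt0.
have [B B0 risk_B] := risk_truncation rho mg e3; set g' := (fun x => _) in risk_B.
have mg' : measurable_fun [set: borelT X] g'.
  by apply: measurable_maxr => //; exact: measurable_minr.
have g'B x : `|g' x| <= B by exact: normr_clamp.
(* Lipschitz constant for functions bounded by [B + 1]: [h] is bounded by [B], and [f] stays within
   [d <= 1] of [h]. *)
pose k1 := l (`|rho| + (B + 1) + 1).
have k10 : 0 < k1 + 1 by rewrite ltr_wpDl// l_ge0.
have d0 : 0 < Num.min 1 (e / 3 / (k1 + 1)) by rewrite lt_min ltr01 divr_gt0.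
set d := Num.min _ _ in d0.
have kd : k1 * d <= e / 3.
  apply: (@le_trans _ _ ((k1 + 1) * (e / 3 / (k1 + 1)))); last by rewrite mulrC divfK// gt_eqF.
  apply: ler_pM; [exact: l_ge0|exact: ltW|by rewrite lerDl|by rewrite /d ge_min lexx orbT].
have [h [hc hn g'h]] := bounded_L1_density P mg' g'B d0.
have mh := continuous_borelT hc.
have [f [Hf fh]] := univ h hc d d0.
exists f => //; have mf := mH f Hf.
have r1 := @risk_le_L1 g' h (B + 1) rho d mg' mh.
have r2 := @risk_le_L1 h f (B + 1) rho d mh mf.
have {}r1 : (risk P l h rho <= risk P l g' rho + (e / 3)%:E)%E.
  apply: le_trans (r1 _ _ g'h) _.
  - by move=> x; rewrite (le_trans (g'B x))// lerDl.
  - by move=> x; rewrite (le_trans (hn x))// lerDl.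
  - by rewrite leeD2l// lee_fin.
have {}r2 : (risk P l f rho <= risk P l h rho + (e / 3)%:E)%E.
  apply: le_trans (r2 _ _ _) _.
  - by move=> x; rewrite (le_trans (hn x))// lerDl.
  - move=> x; rewrite -(subrK (h x) (f x)) (le_trans (ler_normD _ _))// addrC lerD//.
    by rewrite (le_trans (ltW (fh x)))// /d ge_min lexx.
  - apply: (@le_trans _ _ (\int[P]_z d%:E)%E).
      apply: ge0_le_integral => //; first exact: measurable_absB.
      by move=> z _; rewrite lee_fin distrC ltW.
    rewrite integral_cst// -[leRHS]mule1 lee_wpmul2l ?lee_fin ?(ltW d0)//.
    exact: probability_le1.
  - by rewrite leeD2l// lee_fin.
apply: le_trans r2 _; apply: le_trans (leeD r1 (lexx _)) _.
apply: le_trans (leeD (leeD risk_B (lexx _)) (lexx _)) _.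
have -> : e%:E = ((e / 3)%:E + (e / 3)%:E + (e / 3)%:E)%E.
  by rewrite -!EFinD; congr (_%:E); lra.
by rewrite !addeA.
Qed.

End risk.
(** * Uniform deviations *)

Section composite_loss.
Context {R : realType}.

(** Putting [- 2 * rho] inside makes the objective an empirical mean and the risk an expectation of
    one and the same function. *)
Definition composite_loss (X : Type) (l : R -> R) (f : X -> R) (b rho : R)
    (z : X * bool) : R :=
  - (2 * rho) + l (rho - sgnb R z.2 * (f z.1 + b)).

Lemma normr_sgnb y : `|sgnb R y| = 1.
Proof. by case: y; rewrite /sgnb ?normrN normr1. Qed.

Lemma emp_objE (X : Type) (l : R -> R) (S : nat -> X * bool) m f b rho : (0 < m)%N ->
  emp_obj l S m f b rho = m%:R^-1 * \sum_(i < m) composite_loss l f b rho (S i).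
Proof.
move=> m0; rewrite /composite_loss big_split /= mulrDr sumr_const card_ord.
by rewrite -[- (2 * rho) *+ m]mulr_natl mulKf// pnatr_eq0 -lt0n.
Qed.

Section bounds.
Context {X : Type} {l : R -> R} {lam K C kap : R}.
Hypothesis l_nondecr : loss_nondecr l.
Hypothesis l_ge0 : forall z, 0 <= l z.
Let N := (K + 2 * C) * lam.
Hypothesis lip : loss_lipschitz_on l (- N) N kap.

Lemma margin_bound (f : X -> R) b rho (z : X * bool) : (forall x, `|f x| <= K * lam) ->
  `|b| <= C * lam -> `|rho| <= C * lam ->
  - N <= rho - sgnb R z.2 * (f z.1 + b) <= N.
Proof.
move=> fK bC rC; rewrite -ler_norml (le_trans (ler_normB _ _))//.
rewrite normrM normr_sgnb mul1r.
by have := ler_normD (f z.1) b; have := fK z.1; rewrite /N; lra.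
Qed.

(** The length of this range is the constant [b_m] of the theorem, which enters Hoeffding's
    exponent. *)
Lemma composite_loss_bound (f : X -> R) b rho (z : X * bool) :
  (forall x, `|f x| <= K * lam) -> `|b| <= C * lam -> `|rho| <= C * lam ->
  - (2 * (C * lam)) <= composite_loss l f b rho z
    <= - (2 * (C * lam)) + (4 * C * lam + l N).
Proof.
move=> fK bC rC; have := margin_bound z fK bC rC => /andP[_ zN].
have := l_nondecr zN; have := l_ge0 (rho - sgnb R z.2 * (f z.1 + b)).
by move: rC; rewrite ler_norml /composite_loss; lra.
Qed.

(** The margin moves by at most [d + 2 * d + 2 * d] and [2 * rho] by at most [4 * d]; the factor
    [2 + kap] is that of the covering radius. *)
Lemma composite_loss_lipschitz (f f' : X -> R) b b' rho rho' d (z : X * bool) :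
  0 <= kap ->
  (forall x, `|f x| <= K * lam) -> `|b| <= C * lam -> `|rho| <= C * lam ->
  (forall x, `|f' x| <= K * lam) -> `|b'| <= C * lam -> `|rho'| <= C * lam ->
  (forall x, `|f x - f' x| <= d) -> `|b - b'| <= 2 * d -> `|rho - rho'| <= 2 * d ->
  `|composite_loss l f b rho z - composite_loss l f' b' rho' z| <= 5 * (2 + kap) * d.
Proof.
move=> kap0 fK bC rC fK' bC' rC' ff' bb' rr'.
have d0 : 0 <= d by have := normr_ge0 (b - b'); lra.
rewrite /composite_loss; set u := rho - _; set u' := rho' - _.
have uu' : `|l u - l u'| <= kap * (5 * d).
  apply: le_trans (lip (margin_bound z fK bC rC) (margin_bound z fK' bC' rC')) _.
  rewrite ler_wpM2l//.
  have -> : rho - sgnb R z.2 * (f z.1 + b) - (rho' - sgnb R z.2 * (f' z.1 + b')) =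
    (rho - rho') - sgnb R z.2 * ((f z.1 - f' z.1) + (b - b')) by ring.
  rewrite (le_trans (ler_normB _ _))// normrM normr_sgnb mul1r.
  by have := ler_normD (f z.1 - f' z.1) (b - b'); have := ff' z.1; lra.
have -> : - (2 * rho) + l u - (- (2 * rho') + l u') = (l u - l u') - 2 * (rho - rho') by ring.
rewrite (le_trans (ler_normB _ _))// normrM (ger0_norm (ler0n R 2)); lra.
Qed.

End bounds.

Lemma lipschitz_constant_ge0 (l : R -> R) (N kap : R) :
  0 < N -> loss_lipschitz_on l (- N) N kap -> 0 <= kap.
Proof.
move=> N0 lip; have NN : - N <= N by lra.
have h : `|l N - l (- N)| <= kap * `|N - - N| by apply: lip; apply/andP.
have := le_trans (normr_ge0 _) h.
by rewrite pmulr_lge0// normr_gt0 opprK gt_eqF// addr_gt0.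
Qed.

(** Points [- L + j * d] with [j] below the integer part of [2 * L / d]. Rounding the count down
    respects the bound on [J]; the price is a last gap shorter than [2 * d]. *)
Lemma interval_grid (L d : R) : 0 < d -> d <= 2 * L ->
  exists J : nat, exists p : nat -> R,
  [/\ J%:R <= 2 * L / d, forall j, (j < J)%N -> `|p j| <= L &
   forall b, `|b| <= L -> exists j : 'I_J, `|b - p j| <= 2 * d].
Proof.
move=> d0 dL; pose J := Num.truncn (2 * L / d).
have L0 : 0 < L by lra.
have Ld0 : 0 <= 2 * L / d by rewrite divr_ge0 ?(ltW d0)//; lra.
have J0 : (0 < J)%N by rewrite truncn_gt0 ler_pdivlMr ?mul1r.
exists J, (fun j => - L + j%:R * d); split.
- by rewrite truncn_le.
- move=> j jJ; have jd : j%:R * d <= 2 * L.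
    rewrite -ler_pdivlMr//; apply: le_trans (_ : J%:R <= _); last by rewrite truncn_le.
    by rewrite ler_nat ltnW.
  have : 0 <= j%:R * d by rewrite mulr_ge0// ltW.
  by rewrite ler_norml; lra.
- move=> b; rewrite ler_norml => /andP[Lb bL].
  pose u := (b + L) / d; have u0 : 0 <= u by rewrite divr_ge0 ?(ltW d0)//; lra.
  have bE : b = - L + u * d by rewrite /u; field; rewrite gt_eqF.
  (* The grid point just left of [b], clipped to the last one when [b] lies near [L]. *)
  pose j := minn (Num.truncn u) J.-1.
  have jJ : (j < J)%N by rewrite (leq_ltn_trans (geq_minr _ _))// prednK.
  exists (Ordinal jJ) => /=.
  have ju : j%:R <= u.
    by apply: le_trans (_ : (Num.truncn u)%:R <= _); [rewrite ler_nat geq_minl|rewrite truncn_le].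
  have uj : u <= j%:R + 2.
    rewrite /j; case: (leqP (Num.truncn u) J.-1) => [_|Ju].
      by have /andP[_ /ltW] := truncn_itv u0; rewrite -[(Num.truncn u).+1%:R]natr1; lra.
    have uLd : u <= 2 * L / d by rewrite /u ler_pM2r ?invr_gt0//; lra.
    have JE : J%:R = J.-1%:R + 1 :> R by rewrite natr1 prednK.
    by have /andP[_ /ltW] := truncn_itv Ld0; rewrite -/J -[J.+1%:R]natr1 JE; lra.
  have -> : b - (- L + j%:R * d) = (u - j%:R) * d by rewrite {1}bE; ring.
  rewrite normrM (gtr0_norm d0) ler_pM2r// ger0_norm; lra.
Qed.

(** An infimum of natural numbers is attained unless the set is empty, and the empty case has
    infimum [+oo]. *)
Lemma covN_attained (X : Type) (G : set (X -> R)) (e : R) : (covN G e < +oo)%E ->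
  exists n (c : 'I_n -> X -> R), [/\ (n%:R)%:E = covN G e, forall i, G (c i) &
    forall g, G g -> exists i, forall x, `|g x - c i x| <= e].
Proof.
rewrite /covN; set S := [set n | _] => Soo.
have [n0 Sn0] : S !=set0.
  apply/set0P/eqP => S0; move: Soo; rewrite S0 image_set0 ereal_inf0.
  by rewrite ltxx.
have exS : exists n, `[< S n >] by exists n0; exact/asboolP.
have [n /asboolP Sn nmin] := ex_minnP exS.
have [c [Gc cov]] := Sn; exists n, c; split => //.
apply/le_anti/andP; split.
  by apply: le_ereal_inf_tmp => _ [m Sm <-]; rewrite lee_fin ler_nat nmin//; exact/asboolP.
by apply: ereal_inf_lbound; exists n.
Qed.

End composite_loss.

Lemma measure_bigsetU_le d (T : measurableType d) (R : realType) (mu : probability T R)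
    (I : Type) (s : seq I) (F : I -> set T) (q : R) :
  (forall i, measurable (F i)) -> (forall i, mu (F i) <= q%:E)%E ->
  (mu (\big[setU/set0]_(i <- s) F i) <= ((size s)%:R * q)%:E)%E.
Proof.
move=> mF Fq; elim: s => [|i s IH]; first by rewrite big_nil measure0 mul0r.
rewrite big_cons; apply: le_trans (measureU2 _ _ _) _ => //.
  by apply: bigsetU_measurable.
by rewrite /= -natr1 mulrDl mul1r addrC EFinD leeD.
Qed.

Section uniform_deviation.
Context {R : realType} {X : pseudoPMetricType R}
  {P : probability (borelT X * bool)%type R} {l : R -> R}
  {d : measure_display} {Omega : measurableType d} {Pr : probability Omega R}
  {Z : nat -> Omega -> (borelT X * bool)%type}.
Hypothesis l_nondecr : loss_nondecr l.
Hypothesis l_ge0 : forall z, 0 <= l z.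

Lemma measurable_composite_loss (f : borelT X -> R) (b rho : R) : measurable_fun setT f ->
  measurable_fun [set: borelT X * bool] (composite_loss l f b rho).
Proof.
move=> mf; apply: measurable_funD => //.
exact: (@measurable_loss _ _ l f b rho l_nondecr mf).
Qed.

Lemma emp_dev_perturb (f g : borelT X * bool -> R) (e : R) m w : (0 < m)%N ->
  P.-integrable setT (EFin \o f) -> P.-integrable setT (EFin \o g) ->
  (forall z, `|f z - g z| <= e) ->
  `|emp_dev P Z f m w| <= `|emp_dev P Z g m w| + 2 * e.
Proof.
move=> m0 fi gi fg.
have mean : `|m%:R^-1 * (\sum_(i < m) f (Z i w)) - m%:R^-1 * \sum_(i < m) g (Z i w)| <= e.
  rewrite -mulrBr -sumrB normrM ger0_norm ?invr_ge0// ler_pdivrMl ?ltr0n//.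
  apply: le_trans (ler_norm_sum _ _ _) _; apply: le_trans (ler_sum _ (fun i _ => fg _)) _.
  by rewrite sumr_const card_ord mulr_natl.
have expect : `|\int[P]_z f z - \int[P]_z g z| <= e.
  rewrite -RintegralB//; apply: le_trans (le_normr_Rintegral _ _) _ => //.
    by have := integrableB measurableT fi gi; apply: eq_integrable.
  rewrite -[leRHS](Rintegral_prob_cst P); apply: le_Rintegral => //.
  - have := integrable_abse (integrableB measurableT fi gi); exact: eq_integrable.
  - by apply: (@integrable_bounded _ _ _ _ (cst e) `|e|).
rewrite /emp_dev -lerBlDl; apply: le_trans (lerB_dist _ _) _.
set a := m%:R^-1 * _; set a' := m%:R^-1 * _; set i := \int[P]_x f x; set i' := \int[P]_x g x.
have -> : a - i - (a' - i') = (a - a') - (i - i') by ring.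
by apply: le_trans (ler_normB _ _) _; move: mean expect; rewrite -/a -/a' -/i -/i'; lra.
Qed.

Context {lam K C kap : R}.
Let N := (K + 2 * C) * lam.
Let bm := 4 * C * lam + l N.
Hypothesis lip : loss_lipschitz_on l (- N) N kap.
Hypothesis kap0 : 0 <= kap.
Hypothesis iid : iid_law Pr Z P.

(* A union bound of Hoeffding's inequality over a covering of [F] with radius
   [eps / (9 (2 + kap))] and two grids of mesh of the same order for [b] and [rho]. *)
Lemma uniform_deviation (F : set (X -> R)) (n : nat) (c : 'I_n -> X -> R) (eps : R) m :
  (0 < m)%N -> 0 < eps -> 2 * eps <= 4 * C * lam ->
  (forall f, F f -> measurable_fun [set: borelT X] f /\ forall x, `|f x| <= K * lam) ->
  (forall i, F (c i)) ->
  (forall f, F f -> exists i, forall x, `|f x - c i x| <= eps / (9 * (2 + kap))) ->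
  exists E : set Omega, [/\ measurable E,
    (Pr E <= (2 * n%:R * (18 * C * lam * (2 + kap) / eps) ^+ 2 *
              expR (- (2 * m%:R * eps ^+ 2 / (9 * bm ^+ 2))))%:E)%E &
    forall w, ~ E w -> forall f b rho, F f -> `|b| <= C * lam -> `|rho| <= C * lam ->
      `|emp_dev P Z (composite_loss l f b rho) m w| <= 3 * eps].
Proof.
move=> m0 e0 eC FP Fc cover.
have k0 := kap0; have k2 : 0 < 2 + kap by lra.
pose del := eps / (9 * (2 + kap)).
have del0 : 0 < del by rewrite divr_gt0// mulr_gt0.
have delE : del * (9 * (2 + kap)) = eps by rewrite /del divfK// gt_eqF// mulr_gt0.
have delC : del <= 2 * (C * lam) by nra.
have [J [p [Jle pC pcover]]] := interval_grid del0 delC.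
have bm0 : 2 * eps <= bm by rewrite /bm; have := l_ge0 N; lra.
have closs f b rho : F f -> `|b| <= C * lam -> `|rho| <= C * lam ->
    measurable_fun [set: borelT X * bool] (composite_loss l f b rho) /\
    forall z, - (2 * (C * lam)) <= composite_loss l f b rho z <= - (2 * (C * lam)) + bm.
  move=> Ff bC rC; have [mf fK] := FP f Ff.
  by split; [exact: measurable_composite_loss|move=> z; exact: composite_loss_bound].
have closs_int f b rho : F f -> `|b| <= C * lam -> `|rho| <= C * lam ->
    P.-integrable setT (EFin \o composite_loss l f b rho).
  move=> Ff bC rC; have [mf fB] := closs f b rho Ff bC rC.
  apply: (@integrable_bounded _ _ _ _ _ (`|- (2 * (C * lam))| + `|- (2 * (C * lam)) + bm|)) => //.
  by move=> z; exact: normr_itv_bound.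
pose D (t : 'I_n * ('I_J * 'I_J)) :=
  [set w | eps <= `|emp_dev P Z (composite_loss l (c t.1) (p t.2.1) (p t.2.2)) m w|].
have [mZ iidP] := iid.
have mD t : measurable (D t).
  rewrite -[X in measurable X]setTI; apply: measurable_fun_le => //.
  apply: measurableT_comp => //; apply: measurable_emp_dev => //.
  by have [] := closs _ _ _ (Fc t.1) (pC _ (ltn_ord t.2.1)) (pC _ (ltn_ord t.2.2)).
exists (\big[setU/set0]_t D t); split; first exact: bigsetU_measurable.
- pose q := 2 * expR (- (m%:R * eps ^+ 2 / (4 * bm ^+ 2))).
  have Dq t : (Pr (D t) <= q%:E)%E.
    have [mt tB] := closs _ _ _ (Fc t.1) (pC _ (ltn_ord t.2.1)) (pC _ (ltn_ord t.2.2)).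
    exact: (hoeffding mZ iidP mt tB).
  apply: le_trans (measure_bigsetU_le _ mD Dq) _; rewrite lee_fin.
  have -> : size (index_enum ('I_n * ('I_J * 'I_J))%type) = (n * (J * J))%N.
    by rewrite -sum1_size sum1_card !card_prod !card_ord.
  (* The weaker Hoeffding exponent suffices since [1 / 4 >= 2 / 9]. *)
  have qle : q <= 2 * expR (- (2 * m%:R * eps ^+ 2 / (9 * bm ^+ 2))).
    rewrite /q ler_pM2l// ler_expR lerN2.
    have -> : 2 * m%:R * eps ^+ 2 / (9 * bm ^+ 2) = 2 / 9 * (m%:R * eps ^+ 2 / bm ^+ 2).
      by field; lra.
    have -> : m%:R * eps ^+ 2 / (4 * bm ^+ 2) = 1 / 4 * (m%:R * eps ^+ 2 / bm ^+ 2).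
      by field; lra.
    by rewrite ler_wpM2r ?divr_ge0 ?mulr_ge0 ?exprn_ge0 ?(ltW e0)//; lra.
  (* Using the covering radius as grid mesh yields exactly the squared factor of the covering
     condition, one power for [b] and one for [rho]. *)
  have JE : 2 * (C * lam) / del = 18 * C * lam * (2 + kap) / eps.
    by rewrite /del; field; lra.
  rewrite JE in Jle; set A := 18 * C * lam * (2 + kap) / eps in Jle *.
  have JJ : J%:R * J%:R <= A ^+ 2 by rewrite expr2; apply: ler_pM.
  rewrite !natrM.
  apply: (@le_trans _ _ (n%:R * A ^+ 2 * q)).
    rewrite ler_wpM2r ?mulr_ge0 ?expR_ge0//; exact: ler_wpM2l.
  apply: (@le_trans _ _ (n%:R * A ^+ 2 * (2 * expR (- (2 * m%:R * eps ^+ 2 / (9 * bm ^+ 2)))))).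
    by rewrite ler_wpM2l// mulr_ge0// exprn_even_ge0.
  by rewrite le_eqVlt; apply/orP; left; apply/eqP; ring.
- move=> w wE f b rho Ff bC rC.
  have [i fi] := cover f Ff; have [j bj] := pcover b bC; have [j' rj] := pcover rho rC.
  have pj := pC _ (ltn_ord j); have pj' := pC _ (ltn_ord j').
  have close z : `|composite_loss l f b rho z - composite_loss l (c i) (p j) (p j') z| <=
      5 * (2 + kap) * del.
    have [_ fK] := FP f Ff; have [_ cK] := FP _ (Fc i).
    exact: (composite_loss_lipschitz lip).
  have := emp_dev_perturb w m0 (closs_int _ _ _ Ff bC rC) (closs_int _ _ _ (Fc i) pj pj') close.
  have : `|emp_dev P Z (composite_loss l (c i) (p j) (p j')) m w| < eps.
    rewrite ltNge; apply/negP => ?; apply: wE.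
    by rewrite (bigD1 (i, (j, j')))//=; left.
  (* Passing to the net point costs [2 * 5 / 9 * eps], and with [eps] at that point the total stays
     below [3 * eps]. *)
  have : 9 * ((2 + kap) * del) = eps by rewrite -[RHS]delE; ring.
  lra.
Qed.

End uniform_deviation.

(** * Finiteness of the risks and convergence of the estimator *)

Lemma risk_composite_loss (R : realType) (X : pseudoPMetricType R)
    (P : probability (borelT X * bool)%type R) (l : R -> R)
    (f : borelT X -> R) (b rho N : R) :
  loss_nondecr l -> (forall z, 0 <= l z) -> measurable_fun setT f ->
  (forall z, rho - sgnb R z.2 * (f z.1 + b) <= N) ->
  risk P l (fun x => f x + b) rho = (\int[P]_z composite_loss l f b rho z)%:E.
Proof.
move=> lnd l0 mf fN; rewrite /risk.
have li : P.-integrable setT (EFin \o (fun z => l (rho - sgnb R z.2 * (f z.1 + b)))).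
  apply: (@integrable_bounded _ _ _ _ _ (l N)); first exact: (@measurable_loss _ _ l f b rho lnd mf).
  by move=> z; rewrite ger0_norm// lnd.
rewrite EFin_Rintegral// -EFinD; congr (_%:E).
rewrite [RHS]RintegralD//; first by rewrite Rintegral_prob_cst.
by apply: (@integrable_bounded _ _ _ _ (cst (- (2 * rho))) `|- (2 * rho)|).
Qed.

Lemma risk_star_fin_num (R : realType) (X : pseudoPMetricType R)
    (P : probability (borelT X * bool)%type R) (l : R -> R) (B : R) :
  loss_nondecr l -> (forall z, 0 <= l z) ->
  (forall (g : borelT X -> R) rho, measurable_fun setT g -> (B%:E <= risk P l g rho)%E) ->
  risk_star P l \is a fin_num.
Proof.
move=> lnd l0 riskB; rewrite fin_numElt; apply/andP; split.
  apply: (@lt_le_trans _ _ B%:E); first exact: ltNyr.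
  by apply: le_ereal_inf_tmp => _ [g [rho [mg ->]]]; exact: riskB.
have := @risk_composite_loss _ _ P l (cst 0) 0 0 0 lnd l0 (measurable_cst _).
have -> : (fun x : borelT X => cst 0 x + 0 : R) = cst 0 by apply/funext => x; rewrite addr0.
move=> r0; apply: (@le_lt_trans _ _ (risk P l (cst 0) 0)).
  by apply: ereal_inf_lbound; exists (cst 0), 0; split => //; exact: measurable_cst.
by rewrite r0 ?ltry// => z; rewrite /= addr0 mulr0 subr0.
Qed.

Theorem theorem2 (R : realType) (X : pseudoPMetricType R)
  (k : X -> X -> R) (K : R) (H : set (X -> R)) (ip : (X -> R) -> (X -> R) -> R)
  (P : probability (borelT X * bool)%type R) (l : R -> R)
  (d : measure_display) (Omega : measurableType d) (Pr : probability Omega R)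
  (Z : nat -> Omega -> (borelT X * bool)%type)
  (lam : nat -> R) (fhat : nat -> Omega -> X -> R) (bhat rhohat : nat -> Omega -> R)
  (c C : R) (M : nat) (kap : nat -> R) :
  (* X is a compact metric space *)
  hausdorff_space X -> compact [set: X] ->
  (* k is a continuous universal kernel with RKHS (H, ip), bounded by K *)
  continuous (fun p : X * X => k p.1 p.2) ->
  is_RKHS k H ip -> universal_rkhs H ->
  (forall x, Num.sqrt (k x x) <= K) ->
  (* noise condition on P *)
  (exists eps0 : R, 0 < eps0 /\ exists eta : borelT X -> R,
     cond_prob_pos P eta /\
     (0 < P ([set x : borelT X | (eps0 <= eta x <= 1 - eps0)%R] `*` setT))%E) ->
  (* the loss *)
  loss_nondecr l -> loss_convex l -> (forall z, 0 <= l z) ->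
  (forall Mg : R, 0 < Mg -> exists z0 : R, forall z g, z0 <= z -> subdiff l z g -> Mg <= g) ->
  (* i.i.d. sample from P *)
  iid_law Pr Z P ->
  (* regularization parameters *)
  (forall m, 0 < lam m) -> lam @ \oo --> +oo ->
  (* the estimator is an optimal solution of the empirical problem *)
  (forall (m : nat) (w : Omega), (0 < m)%N ->
     (exists f b rho, is_opt l H ip (lam m) (fun i => Z i w) m f b rho) ->
     is_opt l H ip (lam m) (fun i => Z i w) m (fhat m w) (bhat m w) (rhohat m w)) ->
  (* high-probability bounds *)
  0 < c -> 0 < C ->
  (forall m : nat, (M <= m)%N -> (0 < m)%N ->
     exists A : set Omega, measurable A /\
       ((1 - expR (- (c * m%:R)))%:E < Pr A)%E /\
       forall w, A w ->
         is_opt l H ip (lam m) (fun i => Z i w) m (fhat m w) (bhat m w) (rhohat m w) /\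
         rkhs_norm ip (fhat m w) <= lam m /\
         `|bhat m w| <= C * lam m /\ `|rhohat m w| <= C * lam m) ->
  (* Lipschitz constants *)
  (forall m, loss_lipschitz_on l (- ((K + 2 * C) * lam m)) ((K + 2 * C) * lam m) (kap m)) ->
  (* covering number condition *)
  (forall eps : R, 0 < eps ->
     (fun m : nat =>
        ((2%:E * covN [set f | H f /\ (rkhs_norm ip f <= lam m)%R]
                      (eps / (9 * (2 + kap m)))) *
         (((18 * C * lam m * (2 + kap m)) / eps) ^+ 2 *
          expR (- ((2 * m%:R * eps ^+ 2) /
                   (9 * (4 * C * lam m + l ((K + 2 * C) * lam m)) ^+ 2))))%:E)%E)
       @ \oo --> 0%E) ->
  (* conclusion: convergence in (outer) probability *)
  forall eps : R, 0 < eps ->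
    exists B : nat -> set Omega,
      (forall m, measurable (B m) /\
         [set w | ~ (`| risk P l (fun x => (fhat m w x + bhat m w)%R) (rhohat m w)
                       - risk_star P l | <= eps%:E)%E] `<=` B m) /\
      (fun m => Pr (B m)) @ \oo --> 0%E.
Proof.
move=> _ _ kc HR univ kK [e0 [e0_gt0 [eta [etaP noise]]]] lnd lcv l0 lsup iid lam0 lamoo _.
move=> c0 C0 good lip covc eps eps0.
have K0 : 0 <= K by apply: le_trans (kK point); exact: sqrtr_ge0.
have mH f : H f -> measurable_fun [set: borelT X] (f : borelT X -> R).
  by move=> Hf; apply: continuous_borelT; exact: rkhs_continuous kc HR Hf.
pose F m := [set f | H f /\ rkhs_norm ip f <= lam m].
have FP m f : F m f -> measurable_fun [set: borelT X] f /\ forall x, `|f x| <= K * lam m.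
  move=> [Hf fm]; split=> [|x]; first exact: mH.
  apply: le_trans (rkhs_sup_bound HR x Hf) _; rewrite mulrC.
  by apply: ler_pM => //; exact: sqrtr_ge0.
have [B riskB] := risk_bounded_below lcv lnd l0 lsup e0_gt0 etaP noise.
have star_fin := risk_star_fin_num lnd l0 riskB.
(* Budget: [2 * e1] for the suboptimality of [(f0, rho0)], and [3 * e1] for each of the deviations
   at that pair and at the estimator. *)
pose e1 := eps / 8; have e1_gt0 : 0 < e1 by rewrite divr_gt0.
have [_ [g [rho0 [mg ->]]] g_opt] := lb_ereal_inf_adherent e1_gt0 star_fin.
have [f0 Hf0 f0_g] := universal_risk_approx P lcv lnd l0 univ mH rho0 mg e1_gt0.
have f0_opt : (risk P l f0 rho0 <= risk_star P l + (2 * e1)%:E)%E.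
  apply: le_trans f0_g _; apply: le_trans (leeD (ltW g_opt) (lexx _)) _.
  by rewrite -addeA -EFinD (_ : e1 + e1 = 2 * e1)//; lra.
set star := risk_star P l in star_fin f0_opt *.
pose tail m := ((18 * C * lam m * (2 + kap m)) / e1) ^+ 2 *
  expR (- ((2 * m%:R * e1 ^+ 2) / (9 * (4 * C * lam m + l ((K + 2 * C) * lam m)) ^+ 2))).
pose u m := (2%:E * covN (F m) (e1 / (9 * (2 + kap m))) * (tail m)%:E)%E.
have u0 : u @ \oo --> 0%E := covc e1 e1_gt0.
(* All these conditions hold for large [m], as [lam] tends to infinity; for the other [m] the
   enclosing set is [setT]. *)
pose adm m := [/\ (M <= m)%N, (0 < m)%N, rkhs_norm ip f0 <= lam m,
  `|rho0| <= C * lam m & 2 * e1 <= 4 * C * lam m].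
pose bad m := [set w | ~ (`| risk P l (fun x => (fhat m w x + bhat m w)%R) (rhohat m w)
                       - star | <= eps%:E)%E].
have /choice[D DP] : forall m, exists Bm, [/\ measurable Bm, bad m `<=` Bm &
    adm m -> (Pr Bm <= (expR (- (c * m%:R)))%:E + u m)%E].
  move=> m; have [[Mm m0 f0m rho0m e1m]|nadm] := pselect (adm m); last by exists setT.
  have Nm0 : 0 < (K + 2 * C) * lam m by rewrite mulr_gt0// ltr_wpDl// mulr_gt0.
  have kap0 := lipschitz_constant_ge0 Nm0 (lip m).
  have [covoo|covfin] := leP +oo%E (covN (F m) (e1 / (9 * (2 + kap m)))).
    (* With no finite cover [u m] is [+oo], since the tail factor is positive, and the bound is
       trivial. *)
    exists setT; split => // _; move: covoo; rewrite leye_eq => /eqP covoo.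
    have tail0 : 0 < tail m.
      by rewrite mulr_gt0 ?expR_gt0// exprn_gt0// divr_gt0// !mulr_gt0// ltr_wpDr.
    by rewrite /u covoo gt0_muley ?lte_fin// gt0_mulye ?lte_fin// addey// leey.
  have [n [ctr [nE Fctr cover]]] := covN_attained covfin.
  have [E [mE PE Edev]] := uniform_deviation lnd l0 (lip m) kap0 iid m0 e1_gt0 e1m (FP m)
    Fctr cover.
  have [A [mA [PA Aopt]]] := good m Mm m0.
  exists (~` A `|` E); split; first by apply: measurableU => //; exact: measurableC.
  - move=> w wbad; apply: contrapT => /not_orP[/contrapT Aw nEw]; apply: wbad.
    have [[Hfh fhm opt] [_ [bh rh]]] := Aopt w Aw.
    have Fh : F m (fhat m w) by [].
    have F0 : F m f0 by [].
    (* The comparison pair enters the empirical problem with offset 0. *)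
    have b0 : `|0 : R| <= C * lam m by rewrite normr0 mulr_ge0// ltW.
    have [mfh fhK] := FP m _ Fh; have [mf0 f0K] := FP m _ F0.
    have risk_h : risk P l (fun x => fhat m w x + bhat m w) (rhohat m w) =
        (\int[P]_z composite_loss l (fhat m w) (bhat m w) (rhohat m w) z)%:E.
      apply: (@risk_composite_loss _ _ P l _ _ _ ((K + 2 * C) * lam m)) => // z.
      by have /andP[] := margin_bound z fhK bh rh.
    have risk_0 : risk P l f0 rho0 = (\int[P]_z composite_loss l f0 0 rho0 z)%:E.
      rewrite -(@risk_composite_loss _ _ P l f0 0 rho0 ((K + 2 * C) * lam m))//.
        by congr (risk P l _ rho0); apply/funext => x; rewrite addr0.
      by move=> z; have /andP[] := margin_bound z f0K b0 rho0m.
    have star_le : (star <= risk P l (fun x => (fhat m w x + bhat m w)%R) (rhohat m w))%E.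
      apply: ereal_inf_lbound; exists (fun x => fhat m w x + bhat m w), (rhohat m w).
      by split => //; exact: measurable_funD.
    have := Edev w nEw _ _ _ Fh bh rh; have := Edev w nEw _ _ _ F0 b0 rho0m.
    have := opt f0 0 rho0 Hf0 f0m; rewrite !emp_objE// /emp_dev.
    move: star_le f0_opt; rewrite risk_h risk_0 -(fineK star_fin) -EFinD !lee_fin.
    rewrite /e1.
    set i0 := \int[P]_x _; set ih := \int[P]_x _; set s0 := _^-1 * _; set sh := _^-1 * _.
    by rewrite !ler_norml; lra.
  - move=> _; apply: le_trans (measureU2 _ _ _) _ => //; first exact: measurableC.
    rewrite leeD//.
      apply: (@le_trans _ _ (1 - Pr A)%E); first by rewrite -(probability_setC Pr mA).
      move: PA.
      rewrite -(fineK (fin_num_measure Pr _ mA)) -EFinB lte_fin lee_fin; lra.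
    apply: le_trans PE _; rewrite /u /tail -nE -!EFinM lee_fin.
    by rewrite le_eqVlt; apply/orP; left; apply/eqP; ring.
exists D; split; first by move=> m; have [] := DP m.
have adm_near : \forall m \near \oo, adm m.
  near=> m; split.
  - by near: m; exact: nbhs_infty_ge.
  - by near: m; exact: nbhs_infty_gt.
  - by near: m; exact: cvgry_ge.
  - rewrite -ler_pdivrMl//; near: m; exact: cvgry_ge.
  - by rewrite -ler_pdivrMl ?mulr_gt0//; near: m; exact: cvgry_ge.
apply: (@squeeze_cvge _ _ _ _ (cst 0%E) _ (fun m => (expR (- (c * m%:R)))%:E + u m)%E).
- by apply: filterS adm_near => m am; rewrite measure_ge0 /=; have [_ _] := DP m; exact.
- exact: cvg_cst.
- rewrite -[X in _ --> X]adde0; apply: cvgeD => //.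
  apply/cvg_EFin; first exact: nearW.
  apply: (cvg_comp (fun m : nat => c * m%:R) (fun x : R => expR (- x))); last exact: cvgr_expR.
  apply/cvgryPge => r; near=> m; rewrite -ler_pdivrMl//.
  by near: m; exact: nbhs_infty_ger.
Unshelve. all: by end_near.
Qed.
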